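(* Let $\mathcal{F}$ be a family of finite graphs (up to isomorphism) containing at least one graph with at least $2$ vertices. Then the following are equivalent: (i) $\mathcal{F}$ is strongly persistent; (ii) $\mathcal{F}$ is persistent; (iii) $\mathcal{F}$ is closed under substitutions and under induced subgraphs.
   Context: Graphs are finite simple graphs; the graph with no vertices $K_0$ is allowed. A graphon is a symmetric measurable function $W\colon X\times X\to[0,1]$ on an atomless standard probability space $(X,\mathcal{A},\mu)$. For a finite graph $G$, $t_{\mathrm{ind}}(G,W)=\int_{X^{V(G)}}\prod_{\{v,w\}\in E(G)}W(x_v,x_w)\prod_{\{v,w\}\notin E(G),v\neq w}(1-W(x_v,x_w))\,d\mu(x)$ and $\phi_W(G)=\frac{|G|!}{|\mathrm{Aut}(G)|}t_{\mathrm{ind}}(G,W)$. A subgraphon of $W$ is (any graphon representing the same densities as) a graphon $W_f$ on $(X,\mathcal{A},\mu_f)$ with $W_f=W$, where $f\colon X\to[0,1]$ is measurable with $c=\int f\,d\mu>0$ and $\mu_f(B)=\frac1c\int_B f\,d\mu$. Let $Q(W)$ be the set of finite graphs $G$ with $\phi_W(G)>0$ and $P(W)=\bigcap_{W'}Q(W')$ over all subgraphons $W'$ of $W$. $W$ is weakly random if $P(W)=Q(W)$. A family $\mathcal{F}$ is persistent if $\mathcal{F}=P(W)$ for some graphon $W$, and strongly persistent if $\mathcal{F}=P(W)$ for some weakly random graphon $W$. For graphs $F_1,F_2$ and $v\in V(F_1)$, the substitution $F_1^{v\to F_2}$ is obtained from $F_1$ by replacing $v$ by a copy of $F_2$, each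 vertex of the copy being adjacent to exactly the neighbours of $v$ in $F_1-v$. A family is closed under substitutions if $F_1^{v\to F_2}$ belongs to it whenever $F_1,F_2$ do. *)

(* Defs.v *)
From HB Require Import structures.
From mathcomp Require Import all_boot all_order all_algebra.
From mathcomp Require Import all_fingroup.
From mathcomp Require Import all_classical all_reals all_analysis.
From mathcomp Require Import measurable_realfun.

Set Implicit Arguments.
Unset Strict Implicit.
Unset Printing Implicit Defensive.
Import Order.TTheory GRing.Theory Num.Theory.
Import numFieldNormedType.Exports.

Local Open Scope classical_set_scope.
Local Open Scope ring_scope.

(** * Finite simple graphs *)

(* Every finite graph is isomorphic to one with vertex set 'I_n; the vertex
   set is fixed in this form so that [graph] is a small type and families of
   graphs up to isomorphism are isomorphism-closed sets of type [set graph]. *)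
Record graph := Graph {
  gorder : nat;
  adj : rel 'I_gorder;
  adj_sym : symmetric adj;
  adj_irr : irreflexive adj }.

Notation "''V' ( G )" := 'I_(gorder G) (format "''V' ( G )") : type_scope.

Definition giso (G H : graph) : Prop :=
  exists g : 'V(G) -> 'V(H),
    bijective g /\ forall v w, adj (g v) (g w) = adj v w.

Definition aut (G : graph) : {set {perm 'V(G)}} :=
  [set s : {perm 'V(G)} |
    [forall v, forall w, adj (s v) (s w) == adj v w]]%SET.

(* The graph with vertex set T and edge relation e, transported to 'I_#|T|. *)
Section GraphOn.
Variables (T : finType) (e : rel T).
Hypotheses (es : symmetric e) (ei : irreflexive e).

Let e' (i j : 'I_#|T|) : bool := e (enum_val i) (enum_val j).

Fact graph_on_sym : symmetric e'. Proof. by move=> i j; exact: es. Qed.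

Fact graph_on_irr : irreflexive e'. Proof. by move=> i; exact: ei. Qed.

Definition graph_on : graph := Graph graph_on_sym graph_on_irr.
End GraphOn.

Section Induced.
Variables (G : graph) (S : {set 'V(G)}).

Definition induced_adj (x y : {x : 'V(G) | x \in S}) : bool :=
  adj (val x) (val y).

Fact induced_adj_sym : symmetric induced_adj.
Proof. by move=> x y; exact: adj_sym. Qed.

Fact induced_adj_irr : irreflexive induced_adj.
Proof. by move=> x; exact: adj_irr. Qed.

Definition induced_subgraph : graph :=
  graph_on induced_adj_sym induced_adj_irr.
End Induced.

Section Substitution.
Variables (G : graph) (v : 'V(G)) (H : graph).

Definition subst_adj (a b : {x : 'V(G) | x != v} + 'V(H)) : bool :=
  match a, b with
  | inl x, inl y => adj (val x) (val y)
  | inl x, inr _ => adj (val x) v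
  | inr _, inl y => adj v (val y)
  | inr z, inr t => adj z t
  end.

Fact subst_adj_sym : symmetric subst_adj.
Proof. by move=> [x|z] [y|t] /=; exact: adj_sym. Qed.

Fact subst_adj_irr : irreflexive subst_adj.
Proof. by move=> [x|z] /=; exact: adj_irr. Qed.

Definition substitution : graph := graph_on subst_adj_sym subst_adj_irr.
End Substitution.

Definition closed_under_iso (F : set graph) : Prop :=
  forall G H : graph, giso G H -> F G -> F H.

Definition closed_under_substitutions (F : set graph) : Prop :=
  forall (G H : graph) (v : 'V(G)), F G -> F H -> F (substitution v H).

Definition closed_under_induced_subgraphs (F : set graph) : Prop :=
  forall (G : graph) (S : {set 'V(G)}), F G -> F (induced_subgraph S).

(** * Finite powers of a probability space *)

Section Power.
Context d (X : measurableType d) (R : realType) (mu : probability X R).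

Definition tcons n (p : X * n.-tuple X) : n.+1.-tuple X :=
  [the n.+1.-tuple X of p.1 :: p.2].

Fact measurable_tcons n : measurable_fun setT (@tcons n).
Proof. exact: measurable_cons. Qed.

HB.instance Definition _ n :=
  isMeasurableFun.Build _ _ _ _ (@tcons n) (@measurable_tcons n).

Fixpoint power_measure n : probability (n.-tuple X) R :=
  match n with
  | 0 => \d_ [tuple]
  | m.+1 => distribution (mu \x power_measure m)%E (@tcons m)
  end.

Lemma power_measure_box n (A : 'I_n -> set X) :
  (forall i, measurable (A i)) ->
  power_measure n [set x | forall i, A i (tnth x i)] =
  (\prod_(i < n) mu (A i))%E.
Proof.
elim: n A => [|n IHn] A mA /=.
  rewrite big_ord0 diracE mem_set //.
  by case.
rewrite /distribution /pushforward big_ord_recl -IHn; last by move=> i.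
rewrite (_ : _ @^-1` _ =
  A ord0 `*` [set x | forall i, A (lift ord0 i) (tnth x i)]).
  rewrite product_measure1E //.
  rewrite (_ : [set x | _] = \bigcap_(i in [set: 'I_n])
     ((fun x : n.-tuple X => tnth x i) @^-1` A (lift ord0 i))).
    apply: fin_bigcap_measurable => // i _.
    by rewrite -[X in measurable X]setTI; apply: measurable_tnth.
  by apply/seteqP; split=> x /= h i; [move=> _|]; apply: h.
apply/seteqP; split=> -[x t] /=.
  move=> h; split; first exact: (h ord0).
  by move=> i; have := h (lift ord0 i); rewrite tnthS.
move=> [h0 h] i; have [->//|i0] := eqVneq i ord0.
by case: (unliftP ord0 i) i0 => [j ->|->]; rewrite ?eqxx // tnthS.
Qed.
End Power.

(** * Atomless standard probability spaces *)

(* Standard Borel: the measurable sets are the Borel sets of a Polish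
   topology (up to a bijection [g] with the underlying set of a Polish space);
   a Hausdorff [completePseudoMetricType] is completely metrizable. *)
Definition standard_borel (R : realType) d (X : measurableType d) : Prop :=
  exists (T : completePseudoMetricType R) (g : X -> T),
  [/\ hausdorff_space T,
      exists2 D : set T, countable D & dense D,
      bijective g &
      forall A : set X, measurable A <-> <<s [set U : set T | open U] >> (g @` A)].

Definition atomless d (X : measurableType d) (R : realType)
    (mu : set X -> \bar R) : Prop :=
  forall A, measurable A -> (0 < mu A)%E ->
  exists B, [/\ measurable B, B `<=` A, (0 < mu B)%E & (mu B < mu A)%E].

(** * Graphons *)

Record graphon (R : realType) := Graphon {
  gdisp : measure_display;
  gspace : measurableType gdisp;
  gmeas : probability gspace R;
  gstandard : standard_borel R gspace;
  gatomless : atomless gmeas;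
  gker :> gspace -> gspace -> R;
  gker_measurable : measurable_fun setT (fun p => gker p.1 p.2);
  gker_sym : forall x y, gker x y = gker y x;
  gker_range : forall x y, 0 <= gker x y <= 1 }.

Section Densities.
Context (R : realType) (G : graph) (W : graphon R).

(* Each unordered pair {v, w} of distinct vertices is indexed once, by v < w. *)
Definition t_ind : R :=
  \int[power_measure (gmeas W) (gorder G)]_x
    ((\prod_(p : 'V(G) * 'V(G) | (p.1 < p.2)%N && adj p.1 p.2)
        W (tnth x p.1) (tnth x p.2)) *
     (\prod_(p : 'V(G) * 'V(G) | (p.1 < p.2)%N && ~~ adj p.1 p.2)
        (1 - W (tnth x p.1) (tnth x p.2)))).

Definition phi : R := ((gorder G)`!%:R / #|aut G|%:R) * t_ind.
End Densities.

(** * Subgraphons *)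

Record weight d (X : measurableType d) (R : realType) (mu : probability X R) :=
  Weight {
    wfun :> X -> R;
    wfun_measurable : measurable_fun setT wfun;
    wfun_range : forall x, 0 <= wfun x <= 1;
    wfun_gt0 : 0 < \int[mu]_x wfun x }.

Section Reweight.
Context d (X : measurableType d) (R : realType) (mu : probability X R).
Variable f : weight mu.
Local Open Scope ereal_scope.

Definition wmass : R := (\int[mu]_x f x)%R.

Definition reweight (B : set X) : \bar R :=
  (wmass^-1)%:E * \int[mu]_(x in B) (f x)%:E.

Let f0 x : 0 <= (f x)%:E.
Proof. by rewrite lee_fin; have /andP[] := wfun_range f x. Qed.

Let mf : measurable_fun setT (EFin \o f).
Proof. by apply/measurable_EFinP; exact: wfun_measurable. Qed.

Let c0 : (0 < wmass)%R. Proof. exact: wfun_gt0. Qed.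

Let cV0 : 0 < (wmass^-1)%:E. Proof. by rewrite lte_fin invr_gt0. Qed.

Let int_le B : measurable B -> \int[mu]_(x in B) (f x)%:E <= mu B.
Proof.
move=> mB; rewrite -[leRHS]mul1e -integral_cst //.
apply: ge0_le_integral => //.
- exact: (measurable_funTS mf).
- by move=> x _; rewrite lee_fin; have /andP[] := wfun_range f x.
Qed.

Let int_fin B : measurable B -> \int[mu]_(x in B) (f x)%:E \is a fin_num.
Proof.
move=> mB; rewrite ge0_fin_numE; last exact: integral_ge0.
apply: (le_lt_trans (int_le mB)).
by apply: (le_lt_trans (probability_le1 mu mB)); rewrite ltry.
Qed.

Let reweight0 : reweight set0 = 0.
Proof. by rewrite /reweight integral_set0 mule0. Qed.

Let reweight_ge0 B : 0 <= reweight B.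
Proof. by rewrite /reweight mule_ge0 // ?(ltW cV0) // integral_ge0. Qed.

Let reweight_sigma_additive : semi_sigma_additive reweight.
Proof.
move=> F mF tF mUF.
have := @semi_sigma_additive_nng_induced _ _ _ mu _ mf f0 F mF tF mUF.
rewrite /reweight => h.
rewrite [X in X @ _ --> _](_ : _ = (fun n =>
  (wmass^-1)%:E * \sum_(0 <= i < n) \int[mu]_(x in F i) (f x)%:E)).
  by apply: cvgeZl.
apply/funext => n; rewrite ge0_sume_distrr // => i _.
exact: integral_ge0.
Qed.

HB.instance Definition _ := isMeasure.Build _ _ _ reweight
  reweight0 reweight_ge0 reweight_sigma_additive.

Let reweight_setT : reweight setT = 1.
Proof.
rewrite /reweight -[X in _ * X]fineK ?int_fin // -EFinM.
by rewrite mulVf ?gt_eqF.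
Qed.

HB.instance Definition _ :=
  Measure_isProbability.Build _ _ _ reweight reweight_setT.

Let reweight_eq0 A : measurable A -> mu A = 0 -> reweight A = 0.
Proof.
move=> mA A0; have := int_le mA; rewrite A0 => le0.
have -> : reweight A = (wmass^-1)%:E * \int[mu]_(x in A) (f x)%:E by [].
by rewrite (_ : integral _ _ _ = 0) ?mule0 //; apply/eqP;
  rewrite eq_le le0 integral_ge0.
Qed.

Let reweight_gt0 A : measurable A -> (forall x, A x -> (0 < f x)%R) ->
  0 < mu A -> 0 < reweight A.
Proof.
move=> mA fA muA; rewrite /reweight mule_gt0 // lt0e integral_ge0 // andbT.
apply/eqP => int0.
have /ae_eq_integral_abs : \int[mu]_(x in A) `|(EFin \o f) x| = 0.
  by rewrite -[RHS]int0; apply: eq_integral => x _; rewrite gee0_abs /= ?f0.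
move=> /(_ mA (measurable_funTS mf)) [N [mN N0 sN]].
suff : mu A <= 0 by rewrite leNgt muA.
rewrite -N0; apply: le_measure; rewrite ?inE // => x Ax.
apply: sN => /= /(_ Ax) [fx0].
by have := fA _ Ax; rewrite fx0 ltxx.
Qed.

Let reweightDI A B : measurable A -> measurable B ->
  reweight A = reweight (A `\` B) + reweight (A `&` B).
Proof. exact: (measureDI reweight). Qed.

Lemma reweight_atomless : atomless mu -> atomless reweight.
Proof.
move=> atl A mA rA.
pose P := [set x | (0 < f x)%R].
have mP : measurable P.
  rewrite (_ : P = f @^-1` `]0%R, +oo[).
    by rewrite -[X in measurable X]setTI; apply: (wfun_measurable f).
  by apply/funext => x; rewrite /P /= in_itv /= andbT.
have mAP : measurable (A `&` P) by exact: measurableI.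
have rAP : 0 < reweight (A `&` P).
  move: rA; rewrite (reweightDI mA mP).
  have -> : reweight (A `\` P) = 0; last by rewrite add0e.
  rewrite /reweight integral0_eq ?mule0 // => x [_ /negP].
  rewrite -leNgt => fx; congr EFin; apply/eqP; rewrite eq_le fx /=.
  by have /andP[] := wfun_range f x.
have muAP : 0 < mu (A `&` P).
  rewrite lt0e measure_ge0 andbT; apply/eqP => /(reweight_eq0 mAP) r0.
  by rewrite r0 ltxx in rAP.
have [B [mB BAP B0 Blt]] := atl _ mAP muAP.
pose C := (A `&` P) `\` B.
have mC : measurable C by exact: measurableD.
have eC : A `&` P `&` B = B by apply/setIidPr.
have muC : 0 < mu C.
  rewrite lt0e measure_ge0 andbT; apply/eqP => C0.
  have := measureDI mu mAP mB; rewrite eC [X in X + _]C0 add0e => E.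
  by rewrite E ltxx in Blt.
have rB : 0 < reweight B by apply: reweight_gt0 => // x /BAP [].
have rC : 0 < reweight C by apply: reweight_gt0 => // x [[]].
exists B; split => //; first by move=> x /BAP [].
apply: (@lt_le_trans _ _ (reweight (A `&` P))).
  rewrite (reweightDI mAP mB) eC -/C.
  by rewrite lteDr // fin_num_measure.
by apply: le_measure; rewrite ?inE // => x [].
Qed.
End Reweight.

Definition subgraphon_of (R : realType) (W : graphon R)
    (f : weight (gmeas W)) : graphon R :=
  @Graphon R _ (gspace W) (reweight f) (gstandard W)
    (reweight_atomless (@gatomless R W)) W
    (@gker_measurable R W) (@gker_sym R W) (@gker_range R W).

Definition is_subgraphon (R : realType) (W' W : graphon R) : Prop :=
  exists f : weight (gmeas W),
  forall G : graph, t_ind G W' = t_ind G (subgraphon_of f).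

(** * Persistent families *)

Definition Qfam (R : realType) (W : graphon R) : set graph :=
  [set G | 0 < phi G W].

Definition Pfam (R : realType) (W : graphon R) : set graph :=
  [set G | forall W' : graphon R, is_subgraphon W' W -> Qfam W' G].

Definition weakly_random (R : realType) (W : graphon R) : Prop :=
  Pfam W = Qfam W.

Definition persistent (R : realType) (F : set graph) : Prop :=
  exists W : graphon R, F = Pfam W.

Definition strongly_persistent (R : realType) (F : set graph) : Prop :=
  exists W : graphon R, weakly_random W /\ F = Pfam W.

(* Main.v *)
From HB Require Import structures.
Require Import Defs.
From mathcomp Require Import all_boot all_order all_algebra.
From mathcomp Require Import fingroup perm.
From mathcomp Require Import all_classical all_reals all_analysis.
From mathcomp Require Import measurable_realfun zify.

(** Positivity of a density only depends on null sets: G is in P(W) iff for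
    every A of positive measure the tuples of points of A that realize the
    pattern of G in W (W > 0 on edges, W < 1 on non-edges) have positive
    measure. Closure under substitutions then follows from Fubini: for a
    positive set of choices of the other vertices of G, the points that can
    play the role of v have positive measure, hence contain the pattern of H.

    Conversely, given F, take a sequence of graphs g k of F in which each member
    of order at least 2 recurs up to isomorphism, write the points of [0, 1[ in
    the mixed radix given by the orders of the g k, and join two points iff
    their first differing digits, say at place k, are adjacent in g k. Finitely
    many points induce an iterated substitution of members of F. If A has
    positive measure, then at some place k with g k isomorphic to G there is a
    cell all of whose children meet A in positive measure, which realizes G
    inside A. *)

Set Implicit Arguments.
Unset Strict Implicit.
Unset Printing Implicit Defensive.
Import Order.TTheory GRing.Theory Num.Theory.
Import numFieldNormedType.Exports.

Local Open Scope classical_set_scope.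
Local Open Scope ring_scope.

(** * Substitutions and modules *)

(** Induced subgraphs up to isomorphism, without naming a vertex set; [closed_embeds] turns closure
    under [induced_subgraph] into closure under this relation. *)
Definition embeds (G H : graph) : Prop :=
  exists2 h : 'V(G) -> 'V(H),
    injective h & forall v w, adj (h v) (h w) = adj v w.

Lemma giso_sym G H : giso G H -> giso H G.
Proof.
move=> [g [[g' gK g'K] gadj]]; exists g'; split; first by exists g.
by move=> v w; rewrite -gadj !g'K.
Qed.

Lemma graph_on_giso (T : finType) (e : rel T) (es : symmetric e)
    (ei : irreflexive e) (G : graph) (k : T -> 'V(G)) :
  bijective k -> (forall x y, adj (k x) (k y) = e x y) ->
  giso (graph_on es ei) G.
Proof.
move=> kB kadj; exists (k \o enum_val); split.
  exact: bij_comp kB (enum_val_bij T).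
by move=> v w; rewrite /= kadj.
Qed.

Lemma induced_embeds G (S : {set 'V(G)}) : embeds (induced_subgraph S) G.
Proof.
exists (fun i => val (enum_val i)) => // i j /val_inj.
exact: enum_val_inj.
Qed.

Lemma closed_embeds F G H : closed_under_iso F ->
  closed_under_induced_subgraphs F -> embeds G H -> F H -> F G.
Proof.
move=> Fiso Find [h hI hadj] FH.
pose S := [set h v | v : 'V(G)]%SET.
have hS v : h v \in S by apply: imset_f.
pose k (v : 'V(G)) : {x : 'V(H) | x \in S} := Sub (h v) (hS v).
have [k' kK k'K] : bijective k.
  apply: inj_card_bij; first by move=> v w [/hI].
  by rewrite card_sig (eq_card (B := mem S)) // leq_imset_card.
apply: Fiso (Find H S FH); apply: (@graph_on_giso _ _ _ _ _ k');
  first by exists k.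
by move=> x y; rewrite -hadj -[in RHS](k'K x) -[in RHS](k'K y).
Qed.

(** Orders 0 and 1 escape both the digit argument and the recurrent sequence; they are recovered as
    induced subgraphs of a larger member. *)
Lemma embeds_small G H : (gorder G <= 1)%N -> (0 < gorder H)%N -> embeds G H.
Proof.
move=> G1 H0; have vw (v w : 'V(G)) : v = w.
  by apply/val_inj => /=; move: (ltn_ord v) (ltn_ord w); lia.
exists (fun=> Ordinal H0) => v w; first by rewrite (vw v w).
by rewrite (vw v w) !adj_irr.
Qed.

Section Module.
Variables (G : graph) (T : {set 'V(G)}) (t : 'V(G)).
Hypotheses (tT : t \in T)
  (modT : forall x y z, x \notin T -> y \in T -> z \in T -> adj x y = adj x z).

Let Q : {set 'V(G)} := (t |: ~: T)%SET.

Let tQ : t \in Q. Proof. exact: setU11. Qed.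

Definition module_quotient_vertex : 'V(induced_subgraph Q) :=
  enum_rank (Sub t tQ : {x : 'V(G) | x \in Q}).

(** [T] is a module: every outside vertex sees all of it alike. Contracting it to [t] therefore
    loses only its internal edges, which substitution restores. *)
Lemma module_substitution :
  giso (substitution module_quotient_vertex (induced_subgraph T)) G.
Proof.
set t0 := module_quotient_vertex.
pose k (s : {x | x != t0} + 'V(induced_subgraph T)) : 'V(G) :=
  match s with
  | inl x => val (enum_val (val x))
  | inr z => val (enum_val z)
  end.
have kT z : k (inr z) \in T by exact: (valP (enum_val z)).
have kNT x : k (inl x) \notin T.
  have := valP (enum_val (val x)); rewrite !inE => /orP[/eqP xt|//].
  case/negP: (valP x); apply/eqP/enum_val_inj/val_inj.
  by rewrite xt enum_rankK.
have kI : injective k.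
  move=> [x|z] [y|w] kE.
  - by congr inl; apply/val_inj/enum_val_inj/val_inj.
  - by have := kNT x; rewrite kE kT.
  - by have := kNT y; rewrite -kE kT.
  - by congr inr; apply/enum_val_inj/val_inj.
apply: (@graph_on_giso _ _ _ _ _ k).
  (* Surjectivity is by counting: without [t], the quotient has as many vertices as the complement
     of [T]. *)
  apply: inj_card_bij kI _.
  have cardE (U : finType) (A : {set U}) : #|{: {x | x \in A}}| = #|A|.
    by rewrite card_sig; apply: eq_card.
  rewrite card_sum card_sig (eq_card (B := predC1 t0)) // cardC1 !card_ord /=.
  by rewrite !cardE cardsU1 !inE tT /= add0n addnC cardsC card_ord.
have kt0 : val (enum_val t0) = t by rewrite enum_rankK.
move=> [x|z] [y|w] //=.
  rewrite /induced_adj kt0; apply: modT => //; [exact: (kNT x)|exact: (kT w)].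
rewrite /induced_adj kt0 ![adj _ (val (enum_val (val y)))]adj_sym.
by apply: modT => //; [exact: (kNT y)|exact: (kT z)].
Qed.
End Module.

(** * Graphs given by a tree of addresses *)

Definition adjn (G : graph) (i j : nat) : bool :=
  if insub i is Some x then if insub j is Some y then adj (x : 'V(G)) y
  else false else false.

Lemma adjnE (G : graph) (v w : 'V(G)) : adjn G v w = adj v w.
Proof. by rewrite /adjn !valK. Qed.

Lemma adjn_sym (G : graph) : symmetric (adjn G).
Proof.
by move=> i j; rewrite /adjn; case: insub; case: insub => //= x y; exact: adj_sym.
Qed.

Lemma adjn_irr (G : graph) : irreflexive (adjn G).
Proof. by move=> i; rewrite /adjn; case: insub => //= x; exact: adj_irr. Qed.

(* Addresses of level k.+1 refine those of level k: address i has the children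
   i * b, ..., i * b + (b - 1), which carry a copy of g k, where b is its order. *)
Definition tree_edge (g : nat -> graph) (k i j : nat) : bool :=
  (i %/ gorder (g k) == j %/ gorder (g k))%N &&
  adjn (g k) (i %% gorder (g k))%N (j %% gorder (g k))%N.

Lemma tree_edge_sym g k : symmetric (tree_edge g k).
Proof. by move=> i j; rewrite /tree_edge eq_sym adjn_sym. Qed.

Lemma tree_edge_irr g k : irreflexive (tree_edge g k).
Proof. by move=> i; rewrite /tree_edge adjn_irr andbF. Qed.

Section Tree.
Variables (g : nat -> graph) (X : Type) (a : nat -> X -> nat).
Hypothesis g_gt0 : forall k, (0 < gorder (g k))%N.
Hypothesis a_parent : forall k x, a k x = (a k.+1 x %/ gorder (g k))%N.

(** The witness [k] is forced: an edge at level [k] means equal addresses at level [k] and distinct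
    ones at level [k.+1], so [k] is the place of the first differing digit. *)
Definition tree_adj (x y : X) : Prop :=
  exists k, tree_edge g k (a k.+1 x) (a k.+1 y).

Lemma tree_adj_sym x y : tree_adj x y -> tree_adj y x.
Proof. by move=> [k e]; exists k; rewrite tree_edge_sym. Qed.

Lemma tree_adj_irr x : ~ tree_adj x x.
Proof. by move=> [k]; rewrite tree_edge_irr. Qed.

Lemma address_mono k l x y : (k <= l)%N -> a l x = a l y -> a k x = a k y.
Proof.
move=> /subnK <-; elim: (l - k)%N => [//|m IH]; rewrite addSn => E.
by apply: IH; rewrite (a_parent _ x) (a_parent _ y) E.
Qed.

(** An edge at a level below [m] would join equal addresses, against irreflexivity; one above [m]
    would need equal addresses at level [m.+1]. *)
Lemma tree_adj_split m x y : a m x = a m y -> a m.+1 x <> a m.+1 y ->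
  tree_adj x y <-> tree_edge g m (a m.+1 x) (a m.+1 y).
Proof.
move=> am am1; split; last by exists m.
move=> [k e]; suff -> : m = k by [].
apply/eqP; rewrite eqn_leq; apply/andP; split; rewrite leqNgt; apply/negP => lt.
  by move: e; rewrite (address_mono lt am) tree_edge_irr.
have ek : a k x = a k y by move: e => /andP[/eqP]; rewrite -!a_parent.
exact/am1/(address_mono lt).
Qed.

Variable F : set graph.
Hypotheses (Fiso : closed_under_iso F) (Fsub : closed_under_substitutions F)
  (Find : closed_under_induced_subgraphs F) (Fg : forall k, F (g k)).

(* Strong induction on the order: at the first level which separates the
   points, either some address is shared by two of them, and then the points
   with that address form a nontrivial module, or the digits embed G in g m. *)
Lemma tree_induced_in_family (G : graph) (x : 'V(G) -> X) :
  (forall v w, a 0 (x v) = a 0 (x w)) ->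
  (forall v w, v != w -> exists k, a k (x v) <> a k (x w)) ->
  (forall v w, adj v w <-> tree_adj (x v) (x w)) -> F G.
Proof.
have [n] := ubnP (gorder G); elim: n G x => // n IH G x Gn x0 xsep xadj.
have IHsub (S : {set 'V(G)}) : (#|S| < gorder G)%N -> F (induced_subgraph S).
  move=> ltS; apply: (IH (induced_subgraph S) (fun i => x (val (enum_val i)))).
  - by rewrite /= card_sig; apply: leq_trans ltS _.
  - by move=> v w; exact: x0.
  - move=> v w vw; apply: xsep; apply: contraNneq vw => /val_inj/enum_val_inj E.
    exact/eqP.
  - by move=> v w; exact: xadj.
have [G1|] := leqP (gorder G) 1.
  apply: (closed_embeds Fiso Find (H := g 0)) => //.
  exact: embeds_small.
move=> G2.
pose s k := ~~ [forall v, forall w, a k (x v) == a k (x w)].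
have sE k : s k -> exists v w, a k (x v) <> a k (x w).
  by move=> /forallPn[v /forallPn[w /eqP vw]]; exists v, w.
have exs : exists k, s k.
  pose v : 'V(G) := Ordinal (ltnW G2); pose w : 'V(G) := Ordinal G2.
  have [k kvw] := xsep v w isT; exists k.
  by apply/forallPn; exists v; apply/forallPn; exists w; apply/eqP.
(* The least level that separates two of the points is not 0, so it is [m.+1] and all points still
   agree at level [m]. *)
case: (ex_minnP exs) => -[/sE[v [w]]|m sm mmin]; first by rewrite (x0 v w).
have am v w : a m (x v) = a m (x w).
  apply/eqP; have : ~~ s m by apply/negP => /mmin; rewrite ltnn.
  by rewrite negbK => /forallP/(_ v)/forallP/(_ w).
have [/existsP[v /existsP[w /andP[vw /eqP avw]]]|]
  := boolP [exists v : 'V(G), exists w : 'V(G),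
    (v != w) && (a m.+1 (x v) == a m.+1 (x w))].
  (* [T] has at least two vertices, so its quotient is smaller than [G]; it misses a vertex, so the
     graph it induces is smaller too. *)
  pose T : {set 'V(G)} := [set u | a m.+1 (x u) == a m.+1 (x v)]%SET.
  have vT : v \in T by rewrite inE.
  have T2 : (1 < #|T|)%N.
    by rewrite (cardsD1 v) vT (cardsD1 w) !inE eq_sym vw -avw eqxx.
  have TG : (#|T| < gorder G)%N.
    rewrite -[X in (_ < X)%N]card_ord -cardsT; apply: proper_card.
    rewrite properT; apply/negP => /eqP TT.
    have [u [z]] := sE _ sm.
    have aT y : a m.+1 (x y) = a m.+1 (x v).
      by have : y \in T; [rewrite TT inE | rewrite inE => /eqP].
    by rewrite !aT.
  (* A vertex outside [T] parts from every vertex of [T] at the same level, so adjacency depends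
     only on the common address of [T]. *)
  have modT y z z' : y \notin T -> z \in T -> z' \in T -> adj y z = adj y z'.
    rewrite !inE => /eqP yT /eqP zT /eqP zT'.
    have yz : a m.+1 (x y) <> a m.+1 (x z) by rewrite zT.
    have yz' : a m.+1 (x y) <> a m.+1 (x z') by rewrite zT'.
    have E1 := tree_adj_split (am y z) yz;
      have E2 := tree_adj_split (am y z') yz'.
    rewrite zT in E1; rewrite zT' in E2.
    by apply/idP/idP => /xadj; [move/E1/E2/xadj|move/E2/E1/xadj].
  apply: Fiso (module_substitution vT modT) _; apply: Fsub; apply: IHsub => //.
  rewrite cardsU1 !inE eqxx /= add1n.
  have := cardsC T; rewrite card_ord.
  by move=> E; apply: leq_trans (eq_leq E);
    exact: (leq_add T2 (leqnn #|~: T|)%SET).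
rewrite negb_exists => /forallP nvw.
have inj v w : a m.+1 (x v) = a m.+1 (x w) -> v = w.
  move=> E; apply/eqP; apply/negPn/negP => vw.
  by have := nvw v; rewrite negb_exists => /forallP/(_ w); rewrite vw E eqxx.
apply: (closed_embeds Fiso Find (H := g m)) => //.
(* All points have the same parent at level [m], so the last digit determines the address at level
   [m.+1]. *)
exists (fun v => Ordinal (ltn_pmod (a m.+1 (x v)) (g_gt0 m))) => v w.
  move=> [E]; apply: inj.
  rewrite (divn_eq (a m.+1 (x v)) (gorder (g m))) E -a_parent (am v w) a_parent.
  by rewrite -divn_eq.
have [->|vw] := eqVneq v w; first by rewrite !adj_irr.
rewrite -adjnE /=.
have avw : a m.+1 (x v) <> a m.+1 (x w) by move/inj/eqP; rewrite (negbTE vw).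
have E := tree_adj_split (am v w) avw.
have parE : (a m.+1 (x v) %/ gorder (g m) == a m.+1 (x w) %/ gorder (g m))%N.
  by rewrite -!a_parent (am v w).
by apply/idP/idP => [e|/xadj/E/andP[]//]; apply/xadj/E; rewrite /tree_edge parE.
Qed.
End Tree.

(** * Enumeration of a family *)

Definition graph_code := {n : nat & {ffun 'I_n * 'I_n -> bool}}.

Section Decode.
Variable c : graph_code.

(** Codes carry no proofs, hence form a countable type; symmetrizing and removing loops makes every
    code a graph. *)
Definition decode_adj (i j : 'I_(tag c)) : bool :=
  (i != j) && (tagged c (i, j) || tagged c (j, i)).

Fact decode_adj_sym : symmetric decode_adj.
Proof. by move=> i j; rewrite /decode_adj eq_sym orbC. Qed.

Fact decode_adj_irr : irreflexive decode_adj.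
Proof. by move=> i; rewrite /decode_adj eqxx. Qed.

Definition decode_graph : graph := Graph decode_adj_sym decode_adj_irr.
End Decode.

Lemma decode_graph_giso (G : graph) :
  exists c : graph_code, giso (decode_graph c) G.
Proof.
pose f : {ffun 'V(G) * 'V(G) -> bool} := [ffun p => adj p.1 p.2].
exists (Tagged (fun n => {ffun 'I_n * 'I_n -> bool}) f : graph_code).
exists id; split; first by exists id.
move=> v w; rewrite /= /decode_adj /= !ffunE /= (@adj_sym G w v) orbb.
by have [->|_] := eqVneq v w; rewrite ?adj_irr.
Qed.

(* The exponent of 2 takes each value infinitely often. *)
Lemma exists_recurrent_sequence (F : set graph) (G0 : graph) :
  closed_under_iso F -> F G0 -> (2 <= gorder G0)%N ->
  exists g : nat -> graph,
    [/\ forall k, F (g k), forall k, (2 <= gorder (g k))%N &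
        forall G m, F G -> (2 <= gorder G)%N ->
          exists2 k, (m <= k)%N & giso (g k) G].
Proof.
move=> Fiso FG0 G02.
pose good G := F G /\ (2 <= gorder G)%N.
(* The default [G0] keeps every term in [F] and of order at least 2, whatever the code. *)
pose g k := if unpickle (logn 2 k) is Some c then
  if `[< good (decode_graph c) >] then decode_graph c else G0 else G0.
have gg k : good (g k).
  by rewrite /g; case: unpickle => [c|//]; case: ifPn => [/asboolP|].
exists g; split=> [k|k|G m FG G2]; [by case: (gg k)|by case: (gg k)|].
have [c cG] := decode_graph_giso G.
exists (2 ^ pickle c * (2 * m).+1)%N.
  apply: (@leq_trans (1 * (2 * m).+1)); first by lia.
  by rewrite leq_mul2r expn_gt0 orbT.
have -> : g (2 ^ pickle c * (2 * m).+1)%N = decode_graph c; last by [].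
rewrite /g lognM ?expn_gt0 // pfactorK // lognE /= dvdn2 /= oddM /= addn0 pickleK.
rewrite asboolT //; split; first exact: Fiso (giso_sym cG) FG.
by case: cG => h [/bij_eq_card + _]; rewrite !card_ord => ->.
Qed.

(** * Null sets of finite powers *)

Lemma integral_eq0_null d (T : measurableType d) (R : realType)
    (m : {measure set T -> \bar R}) (f : T -> \bar R) :
  measurable_fun setT f -> (forall x, (0 <= f x)%E) ->
  (\int[m]_x f x = 0 <-> m [set x | 0 < f x] = 0)%E.
Proof.
move=> mf f0.
have mP : measurable [set x | (0 < f x)%E].
  rewrite -[X in measurable X]setTI.
  rewrite (_ : [set x | _] = f @^-1` `]0%E, +oo%E]).
    by apply: mf => //; exact: emeasurable_itv.
  by apply/seteqP; split=> x /=; rewrite in_itv /= leey andbT.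
have -> : (\int[m]_x f x = \int[m]_x `|f x|)%E.
  by apply: eq_integral => x _; rewrite gee0_abs.
rewrite (ae_eq_integral_abs m measurableT mf); split.
  move=> [N [mN N0 sN]]; apply: (subset_measure0 mP mN _ N0) => x /= fx.
  by apply: sN => /= /(_ I) fx0; rewrite fx0 ltxx in fx.
move=> P0; exists [set x | (0 < f x)%E]; split => // x /= h.
rewrite lt0e f0 andbT; apply/negP => /eqP fx0; exact: h.
Qed.

(** The product measure is the integral of the measures of sections, so this is Fubini for null
    sets. Positivity questions then need no values of integrals. *)
Lemma product_measure_null d1 d2 (T1 : measurableType d1)
    (T2 : measurableType d2) (R : realType)
    (m1 : {measure set T1 -> \bar R})
    (m2 : {sigma_finite_measure set T2 -> \bar R}) (S : set (T1 * T2)) :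
  measurable S ->
  ((m1 \x m2) S = 0 <-> m1 [set x | 0 < m2 (xsection S x)] = 0)%E.
Proof.
move=> mS; apply: integral_eq0_null => //.
exact: measurable_fun_xsection.
Qed.

Lemma measurable_gt0_xsection d1 d2 (T1 : measurableType d1)
    (T2 : measurableType d2) (R : realType)
    (m2 : {sigma_finite_measure set T2 -> \bar R}) (S : set (T1 * T2)) :
  measurable S -> measurable [set x | (0 < m2 (xsection S x))%E].
Proof.
move=> mS; rewrite -[X in measurable X]setTI.
rewrite (_ : [set x | _] = (m2 \o xsection S) @^-1` `]0%E, +oo%E]).
  by apply: (measurable_fun_xsection m2 mS) => //; exact: emeasurable_itv.
by apply/seteqP; split=> x /=; rewrite in_itv /= leey andbT.
Qed.

Lemma measure_gt0P d (T : measurableType d) (R : realType)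
  (m : {measure set T -> \bar R}) (A : set T) :
  (0 < m A)%E <-> m A <> 0%E.
Proof.
split=> [A0 A1|/eqP A0]; first by rewrite A1 ltxx in A0.
by rewrite lt0e A0 measure_ge0.
Qed.

Lemma subset_measure_gt0 d (T : measurableType d) (R : realType)
    (m : {measure set T -> \bar R}) (A B : set T) :
  measurable A -> measurable B -> A `<=` B -> (0 < m A -> 0 < m B)%E.
Proof.
by move=> mA mB AB A0; apply: lt_le_trans A0 _; apply: le_measure; rewrite ?inE.
Qed.

(** * Splitting and restricting finite powers *)

Section PowerTheory.
Context d (X : measurableType d) (R : realType).
Implicit Types mu nu : probability X R.

Definition box n (A : 'I_n -> set X) : set (n.-tuple X) :=
  [set x | forall i, A i (tnth x i)].

Lemma measurable_box n (A : 'I_n -> set X) :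
  (forall i, measurable (A i)) -> measurable (box A).
Proof.
move=> mA; rewrite (_ : box A = \bigcap_(i in [set: 'I_n])
   ((fun x : n.-tuple X => tnth x i) @^-1` A i)).
  apply: fin_bigcap_measurable => // i _.
  by rewrite -[X in measurable X]setTI; apply: measurable_tnth.
by apply/seteqP; split=> x /= h i; [move=> _|]; apply: h.
Qed.

(** Boxes are stable under intersection and generate the product sigma-algebra, one nontrivial
    factor at a time. *)
Lemma power_measure_unique mu n (P : probability (n.-tuple X) R) :
  (forall A : 'I_n -> set X, (forall i, measurable (A i)) ->
     P (box A) = (\prod_(i < n) mu (A i))%E) ->
  forall B, measurable B -> P B = power_measure mu n B.
Proof.
move=> PE B mB.
pose G : set (set (n.-tuple X)) :=
  [set B | exists2 A : 'I_n -> set X, forall i, measurable (A i) & B = box A].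
have boxT : box (fun _ : 'I_n => setT) = setT by apply/seteqP; split.
apply: (@measure_unique _ _ _ G (fun=> setT)) => //.
- apply/seteqP; split.
    apply: smallest_sub; first exact: smallest_sigma_algebra.
    move=> C; rewrite -bigcup_seq => -[i /= _ [D mD <-]].
    apply: sub_sigma_algebra.
    exists (fun j => if j == i then D else setT) => [j|]; first by case: eqP.
    apply/seteqP; split=> [x [_ Dx] j|x Dx] /=; first by case: eqP => // ->.
    by split => //; have := Dx i; rewrite eqxx.
  apply: smallest_sub; first exact: sigma_algebra_measurable.
  by move=> C [A mA ->]; exact: measurable_box.
- move=> C D [A mA ->] [A' mA' ->]; exists (fun i => A i `&` A' i) => [i|].
    exact: measurableI.
  apply/seteqP; split=> x /=; first by move=> [h h'] i; split.
  by move=> h; split=> i; have [] := h i.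
- by move=> _; exists (fun=> setT).
- by apply/seteqP; split=> // x _; exists 0%N.
- by move=> C [A mA ->]; apply: etrans (PE A mA) _; rewrite -power_measure_box.
- by move=> _; rewrite (le_lt_trans (probability_le1 _ _)) ?ltry.
Qed.

Section Glue.
Variables (n a b : nat) (e : 'I_n -> 'I_a + 'I_b).

(** [e] says from which block each coordinate is read. It need not be onto, so projections that
    forget coordinates are covered as well. *)
Definition merge_tuple (p : a.-tuple X * b.-tuple X) : n.-tuple X :=
  [tuple match e i with inl j => tnth p.1 j | inr j => tnth p.2 j end | i < n].

Lemma tnth_merge_tuple p i : tnth (merge_tuple p) i =
  match e i with inl j => tnth p.1 j | inr j => tnth p.2 j end.
Proof. by rewrite tnth_mktuple. Qed.

Lemma measurable_merge_tuple : measurable_fun setT merge_tuple.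
Proof.
apply/measurable_fun_tnthP => i.
rewrite (_ : _ \o merge_tuple = fun p =>
  match e i with inl j => tnth p.1 j | inr j => tnth p.2 j end); last first.
  by apply/funext => p /=; rewrite tnth_merge_tuple.
case: (e i) => j.
  exact: (measurableT_comp (measurable_tnth j)).
exact: (measurableT_comp (measurable_tnth j)).
Qed.

HB.instance Definition _ := isMeasurableFun.Build _ _ _ _ merge_tuple
  measurable_merge_tuple.

Lemma power_measure_merge mu B : injective e -> measurable B ->
  (power_measure mu a \x power_measure mu b)%E (merge_tuple @^-1` B) =
  power_measure mu n B.
Proof.
move=> eI mB.
pose P : probability (n.-tuple X) R :=
  distribution (power_measure mu a \x power_measure mu b)%E merge_tuple.
rewrite -[LHS]/(P B); apply: power_measure_unique mB => A mA.
(* The constraint on a source coordinate: [A i] at [e i], by injectivity, and the whole space off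
   the image of [e], which contributes a factor 1. *)
pose A' (s : 'I_a + 'I_b) := [set y | forall i, e i = s -> A i y].
have A'E i : A' (e i) = A i.
  by apply/seteqP; split=> y /=; [apply|move=> Ay j /eI ->].
have A'T s : (forall i, e i <> s) -> A' s = setT.
  by move=> es; apply/seteqP; split=> // y _ i /es.
have mA' s : measurable (A' s).
  have [[i <-]|/forallNP/A'T ->//] := pselect (exists i, e i = s).
  by rewrite A'E.
rewrite -[LHS]/((power_measure mu a \x power_measure mu b)%E (merge_tuple @^-1`
  box A)).
rewrite (_ : _ @^-1` _ =
    box (fun j => A' (inl j)) `*` box (fun j => A' (inr j))); last first.
  apply/seteqP; split=> -[x y] /=.
    move=> h; split=> j i ei; have := h i; by rewrite tnth_merge_tuple ei.
  by move=> [hx hy] i; rewrite tnth_merge_tuple; case ei: (e i) => [j|j];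
    [exact: hx|exact: hy].
have boxE k (C : 'I_k -> set X) : (forall i, measurable (C i)) ->
    power_measure mu k (box C) = (\prod_(i < k) mu (C i))%E.
  exact: power_measure_box.
apply: etrans (product_measure1E _ _ (measurable_box _) (measurable_box _))
  _ => //.
apply: etrans (congr2 _ (boxE _ _ _) (boxE _ _ _)) _ => //.
rewrite -(big_sumType _ xpredT (fun s => mu (A' s))) /=.
rewrite (bigID (mem [set e i | i : 'I_n]%SET)) /=.
rewrite [X in (_ * X)%E]big1 ?mule1; last first.
  move=> s /imsetP es; rewrite A'T ?probability_setT // => i ei.
  by apply: es; exists i.
rewrite big_imset /=; last by move=> i j _ _ /eI.
by apply: eq_big => i // _; rewrite A'E.
Qed.
End Glue.

Lemma power_measureS_null mu n (E : set (n.+1.-tuple X)) : measurable E ->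
  power_measure mu n.+1 E = 0%E <->
  mu [set x | 0 < power_measure mu n [set t | E (tcons (x, t))]]%E = 0%E.
Proof.
move=> mE; rewrite /= /distribution /pushforward product_measure_null.
  rewrite (_ : [set x | _] = [set x | (0 < power_measure mu n [set t | E (tcons
    (x, t))])%E]) //.
  by apply/funext => x; rewrite /= xsectionE.
by rewrite -[X in measurable X]setTI; exact: measurable_tcons.
Qed.

Lemma measurable_tcons_section n (E : set (n.+1.-tuple X)) x :
  measurable E -> measurable [set t | E (tcons (x, t))].
Proof.
move=> mE; have := measurable_xsection x (measurable_tcons measurableT mE).
by rewrite setTI xsectionE.
Qed.

Lemma measurable_gt0_tcons_section mu n (E : set (n.+1.-tuple X)) :
  measurable E ->
  measurable [set x | 0 < power_measure mu n [set t | E (tcons (x, t))]]%E.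
Proof.
move=> mE; have := measurable_gt0_xsection (power_measure mu n)
  (measurable_tcons measurableT mE).
rewrite setTI (_ : [set x | _]
  = [set x | (0 < power_measure mu n [set t | E (tcons (x, t))])%E]) //.
by apply/funext => x; rewrite /= xsectionE.
Qed.

Lemma tcons_in_box n (A : set X) x (t : n.-tuple X) :
  box (fun=> A) (tcons (x, t)) <-> A x /\ box (fun=> A) t.
Proof.
split=> [h|[Ax At] i].
  by split=> [|i]; [exact: (h ord0)|have := h (lift ord0 i); rewrite tnthS].
by case: (unliftP ord0 i) => [j ->|->//]; rewrite tnthS; exact: At.
Qed.

(** Peel off the first coordinate: for [x] in [A] the section of the restricted set is a restricted
    section, and for [x] outside [A] it is empty. Since only null sets are compared, no density on
    the power is needed. *)
Lemma power_measure_null_restrict mu nu (A : set X) : measurable A ->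
  (forall B, measurable B -> nu B = 0%E <-> mu (B `&` A) = 0%E) ->
  forall n E, measurable E ->
    power_measure nu n E = 0%E <-> power_measure mu n (E `&` box (fun=> A)) = 0%E.
Proof.
move=> mA nuE; elim=> [|n IH] E mE.
  rewrite /= (_ : E `&` _ = E) //.
  by apply/seteqP; split=> [x []//|x Ex]; split=> // -[].
have mEA : measurable (E `&` box (fun=> A)).
  by apply: measurableI => //; exact: measurable_box.
rewrite !power_measureS_null // nuE; last exact: measurable_gt0_tcons_section.
rewrite (_ : _ `&` A = [set x |
  (0 < power_measure mu n [set t | (E `&` box (fun=> A)) (tcons (x, t))])%E]) //.
have IHx x := IH _ (measurable_tcons_section x mE).
have secE x : A x -> [set t | (E `&` box (fun=> A)) (tcons (x, t))] =
    [set t | E (tcons (x, t))] `&` box (fun=> A).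
  move=> Ax; apply/seteqP; split=> t [Et /=]; rewrite tcons_in_box.
    by move=> [].
  by [].
apply/seteqP; split=> x.
  move=> [/measure_gt0P h Ax]; apply/measure_gt0P.
  by rewrite secE // => h0; apply/h/IHx.
have [Ax /measure_gt0P|Ax] := pselect (A x); last first.
  rewrite /= (_ : [set t | _] = set0) ?measure0 ?ltxx //.
  by apply/seteqP; split=> // t /= [_ /tcons_in_box[]].
by rewrite secE // => h; split=> //; apply/measure_gt0P => /IHx.
Qed.

Lemma power_measure1_gt0 mu (E : set (1.-tuple X)) : measurable E ->
  (0 < power_measure mu 1 E)%E -> (0 < mu [set x | E [tuple x]])%E.
Proof.
move=> mE /measure_gt0P h; apply/measure_gt0P => h0; apply: h.
apply/power_measureS_null => //.
rewrite (_ : [set x | _] = [set x | E [tuple x]]) //.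
apply/funext => x; rewrite /= diracE lte_fin ltr0n lt0b; apply/propext.
rewrite (_ : [tuple x] = tcons (x, [tuple])); last exact: val_inj.
by split=> [|Ex]; [rewrite inE|rewrite mem_set].
Qed.

(* Avoiding a null set which grows by each chosen point gives distinct points. *)
Lemma exists_uniq_tuple mu n (E : set (n.-tuple X)) (N : set X) :
  (forall x : X, measurable [set x]) -> (forall x, mu [set x] = 0%E) ->
  measurable N -> mu N = 0%E -> measurable E -> (0 < power_measure mu n E)%E ->
  exists x, [/\ E x, uniq x & forall y, y \in (x : seq X) -> ~ N y].
Proof.
move=> m1 mu1; elim: n E N => [|n IH] E N mN N0 mE E0.
  have [t Et] : E !=set0.
    by apply/set0P/negP => /eqP E00; rewrite E00 measure0 ltxx in E0.
  by exists t; split=> //; rewrite (tuple0 t).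
pose S := [set x | 0 < power_measure mu n [set t | E (tcons (x, t))]]%E.
have mS : measurable S by exact: measurable_gt0_tcons_section.
(* Were [S] inside the null set [N], [E] would be null. *)
have [x [Sx Nx]] : exists x, S x /\ ~ N x.
  apply: contrapT => /forallNP h.
  have SN : S `<=` N by move=> x Sx; apply: contrapT => Nx; exact: (h x).
  move/measure_gt0P: E0; apply; apply/power_measureS_null => //.
  exact: subset_measure0 mS mN SN N0.
have [t [Et tu tN]] : exists t : n.-tuple X,
    [/\ E (tcons (x, t)), uniq t &
        forall y, y \in (t : seq X) -> ~ (N `|` [set x]) y].
  apply: (IH [set t | E (tcons (x, t))]) => //.
  - exact: measurableU.
  - by apply: null_set_setU => //; exact: mu1.
  - exact: measurable_tcons_section.
exists (tcons (x, t)); split=> //=.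
  by rewrite tu andbT; apply/negP => /tN; apply; right.
move=> y; rewrite inE => /orP[/eqP ->//|/tN h Ny]; apply: h; by left.
Qed.
End PowerTheory.

(** * Positive patterns *)

Lemma prod_unit_interval (R : realType) (I : finType) (P : pred I) (F : I -> R) :
  (forall i, 0 <= F i <= 1) -> 0 <= \prod_(i | P i) F i <= 1.
Proof.
move=> F01; rewrite prodr_ge0 ?prodr_ile1 // => i _.
by case/andP: (F01 i).
Qed.

Lemma prod_gt0P (R : realType) (I : finType) (P : pred I) (F : I -> R) :
  (forall i, 0 <= F i) ->
  0 < \prod_(i | P i) F i <-> forall i, P i -> 0 < F i.
Proof.
move=> F0; split=> [|h]; last exact: prodr_gt0.
rewrite lt0r => /andP[/prodf_neq0 h _] i Pi.
by rewrite lt0r h //=.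
Qed.

(** The bound by 1 makes the extended integral finite, so that [fine] does not turn a positive value
    into 0. *)
Lemma Rintegral_gt0P d (T : measurableType d) (R : realType)
    (P : probability T R) (h : T -> R) : measurable_fun setT h ->
  (forall x, 0 <= h x <= 1) ->
  0 < \int[P]_x h x <-> (0 < P [set x | 0 < h x]%R)%E.
Proof.
move=> mh h01.
have h0 x : (0 <= (h x)%:E)%E by rewrite lee_fin; case/andP: (h01 x).
have mEh : measurable_fun setT (EFin \o h) by exact/measurable_EFinP.
have I0 : (0 <= \int[P]_x (h x)%:E)%E by exact: integral_ge0.
have If : (\int[P]_x (h x)%:E)%E \is a fin_num.
  rewrite ge0_fin_numE //; apply: (@le_lt_trans _ _ (\int[P]_x (cst 1 x))%E).
    apply: ge0_le_integral => // x _; rewrite lee_fin; by case/andP: (h01 x).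
  by rewrite integral_cst // mul1e (le_lt_trans (probability_le1 _ _)) ?ltry.
have E := integral_eq0_null P mEh h0.
have -> : [set x | 0 < h x] = [set x | (0 < (EFin \o h) x)%E].
  by apply/funext => x; rewrite /= lte_fin.
rewrite measure_gt0P -E; split=> [h1 h2|h1].
  by rewrite /Rintegral h2 ltxx in h1.
by rewrite fine_gt0 // lt0e I0 -ge0_fin_numE // If !andbT; apply/eqP.
Qed.

Section Pattern.
Variables (R : realType) (W : graphon R).
Local Notation X := (gspace W).
Local Notation mu := (gmeas W).

(** The positivity set of the integrand of [t_ind], freed from products and from the orientation of
    pairs; see [pattern_density_fun]. *)
Definition pattern (G : graph) : set ((gorder G).-tuple X) :=
  [set x | forall v w : 'V(G), v != w ->
     if adj v w then 0 < W (tnth x v) (tnth x w)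
     else W (tnth x v) (tnth x w) < 1].

Definition density_fun (G : graph) (x : (gorder G).-tuple X) : R :=
  (\prod_(p : 'V(G) * 'V(G) | (p.1 < p.2)%N && adj p.1 p.2)
      W (tnth x p.1) (tnth x p.2)) *
  (\prod_(p : 'V(G) * 'V(G) | (p.1 < p.2)%N && ~~ adj p.1 p.2)
      (1 - W (tnth x p.1) (tnth x p.2))).

Let W01 x y : 0 <= W x y <= 1. Proof. exact: gker_range. Qed.
Let W01' x y : 0 <= 1 - W x y <= 1.
Proof. by case/andP: (W01 x y) => ? ?; rewrite subr_ge0 lerBlDr lerDl;
  apply/andP. Qed.

Lemma density_fun_range G x : 0 <= @density_fun G x <= 1.
Proof.
have /andP[a0 a1] := prod_unit_interval
  (fun p : 'V(G) * 'V(G) => (p.1 < p.2)%N && adj p.1 p.2)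
  (fun p => W01 (tnth x p.1) (tnth x p.2)).
have /andP[b0 b1] := prod_unit_interval
  (fun p : 'V(G) * 'V(G) => (p.1 < p.2)%N && ~~ adj p.1 p.2)
  (fun p => W01' (tnth x p.1) (tnth x p.2)).
by rewrite mulr_ge0 //= mulr_ile1.
Qed.

Lemma measurable_density_fun G : measurable_fun setT (@density_fun G).
Proof.
have mW (p : 'V(G) * 'V(G)) : measurable_fun setT
    (fun x : (gorder G).-tuple X => W (tnth x p.1) (tnth x p.2)).
  exact: (measurableT_comp (@gker_measurable R W)
    (measurable_fun_pair (measurable_tnth p.1) (measurable_tnth p.2))).
apply: measurable_funM.
  under eq_fun do rewrite -big_filter.
  by apply: measurable_prod => p _; exact: mW.
under eq_fun do rewrite -big_filter.
apply: measurable_prod => p _; apply: measurable_funB => //; exact: mW.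
Qed.

Lemma pattern_density_fun G : @pattern G = [set x | 0 < density_fun x].
Proof.
apply/seteqP; split=> x.
  move=> h; apply: mulr_gt0.
    apply/prod_gt0P => [p|p /andP[lt a]];
      first by case/andP: (W01 (tnth x p.1) (tnth x p.2)).
    by have := h p.1 p.2; rewrite a; apply; rewrite -val_eqE /= ltn_eqF.
  apply/prod_gt0P => [p|p /andP[lt a]];
    first by case/andP: (W01' (tnth x p.1) (tnth x p.2)).
  rewrite subr_gt0.
  by have := h p.1 p.2; rewrite (negbTE a); apply; rewrite -val_eqE /= ltn_eqF.
move=> d0.
have [a0 b0] : 0 < \prod_(p : 'V(G) * 'V(G) | (p.1 < p.2)%N && adj p.1 p.2)
      W (tnth x p.1) (tnth x p.2) /\
  0 < \prod_(p : 'V(G) * 'V(G) | (p.1 < p.2)%N && ~~ adj p.1 p.2)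
      (1 - W (tnth x p.1) (tnth x p.2)).
  have /andP[a0 _] := prod_unit_interval
    (fun p : 'V(G) * 'V(G) => (p.1 < p.2)%N && adj p.1 p.2)
    (fun p => W01 (tnth x p.1) (tnth x p.2)).
  have /andP[b0 _] := prod_unit_interval
    (fun p : 'V(G) * 'V(G) => (p.1 < p.2)%N && ~~ adj p.1 p.2)
    (fun p => W01' (tnth x p.1) (tnth x p.2)).
  move: d0; rewrite /= /density_fun lt0r mulf_eq0 negb_or => /andP[/andP[an bn]
    _].
  by split; rewrite lt0r ?an ?bn.
move: a0 => /prod_gt0P a0; move: b0 => /prod_gt0P b0.
have main (v w : 'V(G)) : (v < w)%N -> if adj v w then 0 < W (tnth x v) (tnth x w)
     else W (tnth x v) (tnth x w) < 1.
  move=> vw; case: ifPn => a.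
    apply: (a0 _ (v, w)); last by rewrite /= vw.
    by move=> p; case/andP: (W01 (tnth x p.1) (tnth x p.2)).
  rewrite -subr_gt0; apply: (b0 _ (v, w)); last by rewrite /= vw.
  by move=> p; case/andP: (W01' (tnth x p.1) (tnth x p.2)).
move=> v w; rewrite -val_eqE neq_ltn => /orP[|wv]; first exact: main.
by rewrite adj_sym gker_sym; exact: main.
Qed.

Lemma measurable_pattern G : measurable (@pattern G).
Proof.
rewrite pattern_density_fun -[X in measurable X]setTI.
rewrite (_ : [set x | _] = @density_fun G @^-1` `]0, +oo[).
  by apply: measurable_density_fun.
by apply/funext => x; rewrite /= in_itv /= andbT.
Qed.

Lemma phi_gt0 G : 0 < phi G W <-> 0 < t_ind G W.
Proof.
have c0 : 0 < (gorder G)`!%:R / #|aut G|%:R :> R.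
  rewrite divr_gt0 // ltr0n ?fact_gt0 //; apply/card_gt0P;
    exists (1%g : {perm _}).
  by rewrite inE; apply/forallP => v; apply/forallP => w; rewrite !perm1.
by rewrite /phi pmulr_rgt0.
Qed.
End Pattern.

Lemma t_ind_gt0 (R : realType) (W : graphon R) G :
  0 < t_ind G W <-> (0 < power_measure (gmeas W) (gorder G) (@pattern _ W G))%E.
Proof.
rewrite pattern_density_fun; apply: Rintegral_gt0P;
  first exact: measurable_density_fun.
exact: density_fun_range.
Qed.

Lemma QfamP (R : realType) (W : graphon R) G : Qfam W G <->
  (0 < power_measure (gmeas W) (gorder G) (@pattern _ W G))%E.
Proof. by rewrite -t_ind_gt0 -phi_gt0. Qed.

(** * Subgraphons through supports of weights *)

Section Weights.
Context d (X : measurableType d) (R : realType) (mu : probability X R).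

Definition weight_support (f : weight mu) : set X := [set x | 0 < f x].

Lemma measurable_weight_support f : measurable (weight_support f).
Proof.
rewrite (_ : weight_support f = f @^-1` `]0, +oo[).
  by rewrite -[X in measurable X]setTI; apply: (wfun_measurable f).
by apply/funext => x; rewrite /weight_support /= in_itv /= andbT.
Qed.

Lemma weight_support_gt0 f : (0 < mu (weight_support f))%E.
Proof.
apply/(Rintegral_gt0P _ (wfun_measurable f) (wfun_range f)).
exact: wfun_gt0.
Qed.

Lemma reweight_null f B : measurable B ->
  reweight f B = 0%E <-> mu (B `&` weight_support f) = 0%E.
Proof.
move=> mB.
have mf : measurable_fun setT (EFin \o f).
  by apply/measurable_EFinP; exact: wfun_measurable.
have f0 x : (0 <= (EFin \o f) x)%E.
  by rewrite lee_fin; have /andP[] := wfun_range f x.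
have -> : B `&` weight_support f = [set x | 0 < ((EFin \o f) \_ B) x]%E.
  apply/seteqP; split=> x /=; rewrite patchE.
    by move=> [Bx fx]; rewrite mem_set // lte_fin.
  by case: ifPn; rewrite ?ltxx // inE lte_fin.
rewrite -integral_eq0_null; last 2 first.
- by apply/(measurable_restrictT _ mB); exact: measurable_funTS.
- by move=> x; rewrite patchE; case: ifP.
rewrite -integral_mkcond /reweight; split; last by move=> ->; rewrite mule0.
move=> /eqP; rewrite mule_eq0 => /orP[|/eqP //].
by rewrite eqe invr_eq0 gt_eqF // wfun_gt0.
Qed.

Section Indicator.
Variable A : set X.
Hypotheses (mA : measurable A) (A0 : (0 < mu A)%E).

Let indic_range x : 0 <= (\1_A x : R) <= 1.
Proof. by rewrite indicE; case: (_ \in _); rewrite ?lexx ler01. Qed.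

Let indic_support : [set x | 0 < (\1_A x : R)] = A.
Proof.
apply/funext => x; rewrite /= indicE ltr0n lt0b; apply/propext.
by rewrite inE.
Qed.

Let indic_gt0 : 0 < \int[mu]_x (\1_A x).
Proof.
by apply/Rintegral_gt0P => //; rewrite indic_support.
Qed.

Definition indic_weight : weight mu :=
  Weight (measurable_indic mA) indic_range indic_gt0.

Lemma indic_weight_support : weight_support indic_weight = A.
Proof. exact: indic_support. Qed.
End Indicator.
End Weights.

(** The null sets of a reweighted measure depend only on the support of the weight. Supports have
    positive measure, and indicators realize every measurable set of positive measure as a
    support. *)
Lemma PfamP (R : realType) (W : graphon R) G : Pfam W G <->
  forall A, measurable A -> (0 < gmeas W A)%E ->
  (0 < power_measure (gmeas W) (gorder G) (@pattern _ W G `&` box (fun=> A)))%E.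
Proof.
have main f : 0 < t_ind G (subgraphon_of f) <->
    (0 < power_measure (gmeas W) (gorder G)
      (@pattern _ W G `&` box (fun=> weight_support f)))%E.
  rewrite t_ind_gt0 !measure_gt0P.
  apply: not_iff_compat.
  apply: (@power_measure_null_restrict _ _ _ (gmeas W) (reweight f)
    (weight_support f)).
  - exact: measurable_weight_support.
  - exact: reweight_null.
  - exact: measurable_pattern.
split=> [h A mA A0|h W' [f fE]].
  pose f := indic_weight mA A0.
  have : Qfam (subgraphon_of f) G by apply: h; exists f.
  by move=> /phi_gt0/main; rewrite indic_weight_support.
apply/phi_gt0; rewrite fE; apply/main/h.
  exact: measurable_weight_support.
exact: weight_support_gt0.
Qed.

(** * Closure properties of P(W) *)

Lemma Pfam_Qfam (R : realType) (W : graphon R) G : Pfam W G -> Qfam W G.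
Proof.
move=> /PfamP/(_ setT measurableT); rewrite probability_setT => /(_ lte01) h.
apply/QfamP; apply: subset_measure_gt0 h.
- by apply: measurableI; [exact: measurable_pattern|exact: measurable_box].
- exact: measurable_pattern.
- by move=> x [].
Qed.

(** Forgetting the coordinates outside the image of [h] sends the pattern of [H] into that of
    [G]. *)
Lemma Pfam_embeds (R : realType) (W : graphon R) G H :
  embeds G H -> Pfam W H -> Pfam W G.
Proof.
move=> [h hI hadj] /PfamP PH; apply/PfamP => A mA A0.
(* With an empty second block, merging is the projection along [h]. *)
pose e (v : 'V(G)) : 'V(H) + 'I_0 := inl (h v).
have mG : measurable (@pattern _ W G `&` box (fun=> A)).
  by apply: measurableI; [exact: measurable_pattern|exact: measurable_box].
have eI : injective e by move=> v w [/hI].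
apply/measure_gt0P => /(etrans (power_measure_merge (gmeas W) eI mG)).
move=> /product_measure_null h0.
have mS : measurable (merge_tuple e @^-1` (@pattern _ W G `&` box (fun=> A))).
  by rewrite -[X in measurable X]setTI; exact: measurable_merge_tuple.
suff /measure_gt0P : (0 < power_measure (gmeas W) (gorder H) [set x |
    0 < power_measure (gmeas W) 0 (xsection
      (merge_tuple e @^-1` (@pattern _ W G `&` box (fun=> A))) x)])%E.
  by apply; apply: h0.
apply: subset_measure_gt0 (PH A mA A0).
- by apply: measurableI; [exact: measurable_pattern|exact: measurable_box].
- exact: measurable_gt0_xsection.
move=> x [px Ax] /=; rewrite diracE mem_set ?lte01 //.
apply/xsectionP; split=> [v w vw|v] /=; rewrite !tnth_merge_tuple /=;
  last exact: Ax.
by rewrite -hadj; apply: px; rewrite (inj_eq hI).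
Qed.

Lemma measurable_tuple1 d (X : measurableType d) (B : set (1.-tuple X)) :
  measurable B -> measurable [set y | B [tuple y]].
Proof.
move=> mB; rewrite -[X in measurable X]setTI.
apply: (_ : measurable_fun setT (fun y : X => [tuple y])) => //.
by apply/measurable_fun_tnthP => i; rewrite (ord1 i); exact: measurable_id.
Qed.

(* For a fixed tuple x of images of the other vertices of G, the images y of v
   which complete x to the pattern of G form a set S; wherever S has positive
   measure, it contains the pattern of H, as H belongs to Pfam W. *)
Lemma Pfam_substitution (R : realType) (W : graphon R) (G H : graph)
  (v : 'V(G)) : Pfam W G -> Pfam W H -> Pfam W (substitution v H).
Proof.
move=> /PfamP PG /PfamP PH; apply/PfamP => A mA A0.
pose U : finType := {x : 'V(G) | x != v}.
(* Both maps put the vertices of [G] other than [v] in the first block; the second holds the copy of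
   [H] for [e], and [v] alone for [e1]. *)
pose e (i : 'V(substitution v H)) : 'I_#|U| + 'V(H) :=
  match enum_val i with inl x => inl (enum_rank x) | inr z => inr z end.
pose e1 (u : 'V(G)) : 'I_#|U| + 'I_1 :=
  if insub u is Some x then inl (enum_rank (x : U)) else inr ord0.
have e1U (x : U) : e1 (val x) = inl (enum_rank x) by rewrite /e1 valK.
have e1v : e1 v = inr ord0 by rewrite /e1 insubN //= eqxx.
have eI : injective e.
  move=> i j eij; apply: enum_val_inj; move: eij; rewrite /e.
  by case: (enum_val i) => x; case: (enum_val j) => y // [];
    [move/enum_rank_inj ->|move->].
have e1I : injective e1.
  move=> u w; have [->|uv] := eqVneq u v; have [->|wv] := eqVneq w v => //.
  - by rewrite e1v -[w]/(val (Sub w wv : U)) e1U.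
  - by rewrite e1v -[u]/(val (Sub u uv : U)) e1U.
  rewrite -[u]/(val (Sub u uv : U)) -[w]/(val (Sub w wv : U)) !e1U.
  by move=> [/enum_rank_inj ->].
have mP K (B : set (gspace W)) : measurable B ->
    measurable (@pattern _ W K `&` box (fun=> B)).
  by move=> mB; apply: measurableI;
    [exact: measurable_pattern|exact: measurable_box].
pose Z := merge_tuple e @^-1` (@pattern _ W (substitution v H) `&` box (fun=> A)).
pose Z1 := merge_tuple e1 @^-1` (@pattern _ W G `&` box (fun=> A)).
have mZ : measurable Z.
  rewrite -[X in measurable X]setTI; apply: measurable_merge_tuple => //.
  exact: mP.
have mZ1 : measurable Z1.
  rewrite -[X in measurable X]setTI; apply: measurable_merge_tuple => //.
  exact: mP.
apply/measure_gt0P => /(etrans (power_measure_merge (gmeas W) eI (mP _ _ mA))).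
move=> /(product_measure_null _ _ mZ) Z0.
have /measure_gt0P := PG A mA A0; apply.
apply: (etrans (esym (power_measure_merge (gmeas W) e1I (mP _ _ mA)))).
apply/(product_measure_null _ _ mZ1).
(* It remains to see that a tuple [x] whose [Z1]-section has positive measure also has a [Z]-section
   of positive measure. *)
apply: subset_measure0 Z0; [exact: measurable_gt0_xsection..|].
move=> x /= x0.
pose S := [set y | xsection Z1 x [tuple y]].
have mS : measurable S by apply/measurable_tuple1/measurable_xsection.
have S0 : (0 < gmeas W S)%E.
  by apply: power_measure1_gt0 x0; exact: measurable_xsection.
have Z1E (u : U) y : tnth (merge_tuple e1 (x, [tuple y])) (val u)
  = tnth x (enum_rank u).
  by rewrite tnth_merge_tuple e1U.
have Z1v y : tnth (merge_tuple e1 (x, [tuple y])) v = y.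
  by rewrite tnth_merge_tuple e1v.
(* Conditions among the other vertices of [G] do not involve the image of [v], so a single point of
   [S] yields them. *)
have [y0 Sy0] : S !=set0.
  by apply/set0P; apply: contraTneq S0 => ->; rewrite measure0 ltxx.
apply: subset_measure_gt0 (PH S mS S0); [exact: mP|exact: measurable_xsection|].
move=> t [pt St]; apply/xsectionP; split=> [i j ij|i];
  rewrite !tnth_merge_tuple /e.
  rewrite [adj i j]/(subst_adj (enum_val i) (enum_val j)).
  have : enum_val i != enum_val j by rewrite (inj_eq enum_val_inj).
  case: (enum_val i) => [u|z]; case: (enum_val j) => [w|z'] /= ne.
  - have /xsectionP[/(_ (val u) (val w)) + _] := Sy0.
    by rewrite !Z1E; apply; rewrite (inj_eq val_inj).
  - have /xsectionP[/(_ (val u) v) + _] := St z'.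
    by rewrite Z1E Z1v; apply; exact: (valP u).
  - have /xsectionP[/(_ v (val w)) + _] := St z.
    by rewrite Z1E Z1v; apply; rewrite eq_sym; exact: (valP w).
  - by apply: pt.
case: (enum_val i) => [u|z].
  by have /xsectionP[_ /(_ (val u))] := Sy0; rewrite Z1E.
by have /xsectionP[_ /(_ v)] := St z; rewrite Z1v.
Qed.

(** * The mixed radix graphon *)

Section UnitInterval.
Variable R : realType.

Definition unit_prob : probability (measurableTypeR R) R :=
  uniform_prob (@ltr01 R).

Lemma unit_probE (A : set (measurableTypeR R)) : measurable A ->
  unit_prob A = lebesgue_measure (A `&` `[0%R, 1%R]).
Proof.
move=> mA; rewrite -[LHS]/(\int[lebesgue_measure]_(x in A)
  (uniform_pdf 0 1 x)%:E)%E.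
have mAI : measurable (A `&` `[0%R, 1%R]) by exact: measurableI.
rewrite integral_uniform_pdf (eq_integral (fun=> 1%:E)) ?integral_cst ?mul1e //.
move=> x; rewrite inE => -[_ /=]; rewrite in_itv /uniform_pdf /= => ->.
by rewrite subr0 invr1.
Qed.

Lemma unit_prob_set1 x : unit_prob [set x] = 0%E.
Proof.
rewrite unit_probE //; apply/eqP; rewrite -measure_le0 -(lebesgue_measure_set1 x).
by apply: le_measure; rewrite ?inE //; exact: measurableI.
Qed.

(** The uniform law lives on the closed interval. Its endpoint 1, whose address is out of range, is
    null. *)
Lemma unit_prob_outside : unit_prob (~` `[0%R, 1%R[) = 0%E.
Proof.
rewrite unit_probE; last exact: measurableC.
apply/eqP; rewrite -measure_le0 -(lebesgue_measure_set1 (1 : R)).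
apply: le_measure; rewrite ?inE //; first by apply: measurableI => //;
  exact: measurableC.
move=> x /= []; rewrite !in_itv /= => xn /andP[x0 x1].
by apply/eqP; rewrite eq_le x1 leNgt; apply/negP => lt1; apply: xn; rewrite x0.
Qed.

Lemma unit_prob_itv (A : set (measurableTypeR R)) (u v : R) : measurable A ->
  A `&` `[0%R, 1%R] `<=` `[u, v]%classic -> (u <= v) ->
  (unit_prob A <= (v - u)%:E)%E.
Proof.
move=> mA Auv uv; rewrite unit_probE //.
apply: (@le_trans _ _ (lebesgue_measure (`[u, v]%classic : set R))).
  by apply: le_measure => //; rewrite inE //; exact: measurableI.
rewrite lebesgue_measure_itv /= lte_fin; case: ifPn => // _.
by rewrite lee_fin subr_ge0.
Qed.

Lemma unit_standard : standard_borel R (measurableTypeR R).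
Proof.
exists (R : completePseudoMetricType R), id; split.
- exact: Rhausdorff.
- exists (@ratr R @` setT); last exact: dense_rat.
  exact: card_le_trans (card_image_le _ _) (countableP _).
- by exists id.
move=> A; rewrite image_id; split=> mA.
  have : (@RGenOpens.G R).-sigma.-measurable A by rewrite -RGenOpens.measurableE.
  apply: smallest_sub; first exact: smallest_sigma_algebra.
  by move=> _ [x [y ->]]; apply: sub_sigma_algebra; exact: interval_open.
move: mA; apply: smallest_sub; first exact: sigma_algebra_measurable.
by move=> U /= Uo; exact: open_measurable.
Qed.
End UnitInterval.

(** * Mixed radix addresses *)

Section Address.
Variables (R : realType) (g : nat -> graph).
Hypothesis g2 : forall k, (2 <= gorder (g k))%N.
Local Notation X := (measurableTypeR R).
Local Notation mu := (unit_prob R).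

Definition ncells (k : nat) : nat := (\prod_(i < k) gorder (g i))%N.

(** The first [k] mixed radix digits of [x], read as one integer. Negative reals get address 0 at
    every level, which keeps [address_parent] true on the whole line. *)
Definition address (k : nat) (x : X) : nat :=
  Num.truncn ((ncells k)%:R * (x : R)).

Definition cell (k j : nat) : set X := [set x | address k x = j].

Lemma ncellsS k : ncells k.+1 = (ncells k * gorder (g k))%N.
Proof. by rewrite /ncells big_ord_recr. Qed.

Lemma ncells_gt k : (k < ncells k)%N.
Proof.
elim: k => [|k IH]; first by rewrite /ncells big_ord0.
rewrite ncellsS; have := g2 k; move: IH; nia.
Qed.

Let n0 k : 0 < (ncells k)%:R :> R.
Proof. by rewrite ltr0n; exact: leq_ltn_trans (ncells_gt k). Qed.

Let g_gt0 k : (0 < gorder (g k))%N. Proof. exact: ltnW (g2 k). Qed.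

Lemma address_parent k x : address k x = (address k.+1 x %/ gorder (g k))%N.
Proof.
have [x0|x0] := ltP (x : R) 0.
  have neg l : address l x = 0%N.
    by apply/truncn0Pn; rewrite -ltNge (lt_le_trans _ ler01) // pmulr_rlt0.
  by rewrite !neg div0n.
have /truncn_itv/andP[] : 0 <= (ncells k.+1)%:R * (x : R) by rewrite mulr_ge0.
rewrite -/(address k.+1 x) ncellsS => lo hi.
apply: truncn_def; set t := address k.+1 x in lo hi *.
have b0 : 0 < (gorder (g k))%:R :> R by rewrite ltr0n.
rewrite -(ler_pM2r b0) -[X in _ && X](ltr_pM2r b0).
rewrite [_ * x * _]mulrAC -!natrM; apply/andP; split.
  by apply: le_trans lo; rewrite ler_nat leq_divM.
apply: lt_le_trans hi _; rewrite ler_nat.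
by rewrite ltn_ceil.
Qed.

Lemma measurable_cell k j : measurable (cell k j).
Proof.
have mle i : measurable [set x : X | (address k x <= i)%N].
  rewrite (_ : [set x | _] = `]-oo, (i.+1%:R / (ncells k)%:R)[%classic) //.
  (* Initial segments of addresses pull back to half-lines, negative reals included. *)
  apply/funext => x; rewrite /= /address truncn_le_nat in_itv /=.
  by rewrite ltr_pdivlMr // mulrC.
case: j => [|j].
  rewrite (_ : cell k 0 = [set x | (address k x <= 0)%N]) //.
  by apply/seteqP; split=> x; rewrite /cell /= leqn0 => /eqP.
rewrite (_ : cell k j.+1 =
  [set x | (address k x <= j.+1)%N] `\` [set x | (address k x <= j)%N]).
  exact: measurableD.
apply/seteqP; split=> x; rewrite /cell /=; first by move=> ->; rewrite ltnn.
by move=> [h1 /negP h2]; apply/eqP; rewrite eqn_leq h1 ltnNge.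
Qed.

Lemma cell_le k j : (mu (cell k j) <= ((ncells k)%:R^-1)%:E)%E.
Proof.
have nE : (ncells k)%:R^-1 = j.+1%:R / (ncells k)%:R - j%:R / (ncells k)%:R :> R.
  by rewrite -mulrBl -natrB // subSnn mul1r.
rewrite nE; apply: unit_prob_itv; first exact: measurable_cell.
  move=> x [] /= jx; rewrite !in_itv /= => /andP[x0 _].
  have /truncn_itv : 0 <= (ncells k)%:R * (x : R) by rewrite mulr_ge0.
  rewrite -/(address k x) jx => /andP[lo /ltW hi].
  by rewrite ler_pdivrMr // ler_pdivlMr // mulrC lo hi.
by rewrite ler_pM2r ?invr_gt0 // ler_nat.
Qed.

Lemma address_lt k x : `[0%R, 1%R[%classic x -> (address k x < ncells k)%N.
Proof.
rewrite /= in_itv /= => /andP[x0 x1]; rewrite truncn_lt_nat ?mulr_ge0 //.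
by rewrite gtr_pMr.
Qed.

(** Points with the same address at level [k] are less than [1 / ncells k] apart, and [ncells k]
    exceeds [k]. *)
Lemma address_separates (x y : X) :
  `[0%R, 1%R[%classic x -> `[0%R, 1%R[%classic y -> x != y ->
  exists k, address k x <> address k y.
Proof.
rewrite /= !in_itv /= => /andP[x0 _] /andP[y0 _] xy.
have [k hk] : exists k, 1 <= (ncells k)%:R * `|(x : R) - y|.
  have d0 : 0 < `|(x : R) - y| by rewrite normr_gt0 subr_eq0.
  exists (Num.truncn (`|(x : R) - y|^-1)); rewrite -ler_pdivrMr // mul1r ltW //.
  apply: lt_le_trans (truncnS_gt _) _; rewrite ler_nat; exact: ncells_gt.
exists k => E.
have /truncn_itv/andP[] : 0 <= (ncells k)%:R * (x : R) by rewrite mulr_ge0.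
have /truncn_itv/andP[] : 0 <= (ncells k)%:R * (y : R) by rewrite mulr_ge0.
rewrite -/(address k x) -/(address k y) E -natr1 => a1 a2 a3 a4.
suff : (ncells k)%:R * `|(x : R) - y| < 1 by rewrite ltNge hk.
rewrite -{1}(ger0_norm (ltW (n0 k))) -normrM mulrBr ltr_norml.
apply/andP; split.
  by rewrite ltrBrDl ltrBlDr (lt_le_trans a2) // lerD2r.
by rewrite ltrBlDr addrC (lt_le_trans a4) // lerD2r.
Qed.

Lemma le_sum_cells k (A : set X) : measurable A ->
  (mu A <= \sum_(j < ncells k) mu (A `&` cell k j))%E.
Proof.
move=> mA; have mI : measurable (`[0%R, 1%R[%classic : set X) by [].
have mAI : measurable (A `&` `[0%R, 1%R[%classic) by exact: measurableI.
have mAC j : measurable (A `&` cell k j).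
  by apply: measurableI => //; exact: measurable_cell.
have -> : mu A = mu (A `&` `[0%R, 1%R[%classic).
  rewrite (measureDI mu mA mI) [X in (X + _)%E](_ : _ = 0%E) ?add0e //.
  apply: subset_measure0 (unit_prob_outside R).
  - exact: measurableD.
  - exact: measurableC.
  - by move=> x [].
apply: (@content_subadditive _ _ _ mu _ (fun j => A `&` cell k j)) => //.
move=> x [Ax x01].
have : (\bigcup_(j in `I_(ncells k)) (A `&` cell k j)) x.
  by exists (address k x) => //=; exact: address_lt.
by rewrite bigcup_mkord.
Qed.

(** Take cells smaller than the measure of [A]: one of them meets [A] in positive measure, and that
    intersection is too small to have the full measure. *)
Lemma unit_atomless : atomless mu.
Proof.
move=> A mA A0; have Af : mu A \is a fin_num by exact: fin_num_measure.
have fA0 : 0 < fine (mu A) by rewrite fine_gt0 // A0 -ge0_fin_numE ?Af.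
pose k := Num.truncn (fine (mu A))^-1.
have kA : ((ncells k)%:R^-1%:E < mu A)%E.
  rewrite -(fineK Af) lte_fin invf_plt ?posrE //.
  by apply: lt_le_trans (truncnS_gt _) _; rewrite ler_nat; exact: ncells_gt.
have mAC j : measurable (A `&` cell k j).
  by apply: measurableI => //; exact: measurable_cell.
have [j j0] : exists j, (0 < mu (A `&` cell k j))%E.
  apply: contrapT => /forallNP h; move: A0; apply/negP; rewrite -leNgt.
  apply: le_trans (le_sum_cells k mA) _; rewrite big1 // => j _.
  apply/eqP; rewrite eq_le measure_ge0 andbT leNgt; exact/negP/h.
exists (A `&` cell k j); split => //.
apply: le_lt_trans kA; apply: le_trans (cell_le k j).
by apply: le_measure; rewrite ?inE //; exact: measurable_cell.
Qed.

Definition tree_ker (x y : X) : R := (`[< tree_adj g address x y >])%:R.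

Lemma tree_ker_measurable : measurable_fun setT (fun p => tree_ker p.1 p.2).
Proof.
pose S := [set p : X * X | tree_adj g address p.1 p.2].
have -> : (fun p => tree_ker p.1 p.2) = \1_S.
  apply/funext => p; rewrite indicE /tree_ker; congr (nat_of_bool _)%:R.
apply: measurable_indic.
(* Adjacency is a countable union of rectangles of cells, over the level and the two addresses. *)
rewrite (_ : S = \bigcup_k \bigcup_i \bigcup_j
  (if tree_edge g k i j then cell k.+1 i `*` cell k.+1 j else set0)).
  apply: bigcupT_measurable => k; apply: bigcupT_measurable => i.
  apply: bigcupT_measurable => j; case: ifP => // _.
  by apply: measurableX; exact: measurable_cell.
apply/seteqP; split=> -[x y].
  move=> [k e]; exists k => //; exists (address k.+1 x) => //.
  by exists (address k.+1 y) => //; rewrite e.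
by move=> [k _ [i _ [j _]]]; case: ifP => // e [xi yj]; exists k;
  rewrite (xi : _ = i) (yj : _ = j).
Qed.

Lemma tree_ker_sym x y : tree_ker x y = tree_ker y x.
Proof.
congr (nat_of_bool _)%:R; apply/asboolP/asboolP; exact: tree_adj_sym.
Qed.

Lemma tree_ker_range x y : 0 <= tree_ker x y <= 1.
Proof. by rewrite /tree_ker; case: asbool; rewrite ?lexx ?ler01. Qed.

Definition tree_graphon : graphon R :=
  Graphon (unit_standard R) unit_atomless tree_ker_measurable tree_ker_sym
    tree_ker_range.

Lemma tree_patternP G (x : (gorder G).-tuple X) :
  @pattern _ tree_graphon G x <->
  forall v w : 'V(G), adj v w <-> v != w /\ tree_adj g address (tnth x v)
    (tnth x w).
Proof.
split=> h v w.
  have [->|vw] := eqVneq v w; first by rewrite adj_irr; split=> [|[]].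
  have := h v w vw; rewrite /= /tree_ker; case: (adj v w).
    by case: asboolP => [//|_]; rewrite ltxx.
  by case: asboolP => [_|n _]; [rewrite ltxx|split=> // -[]].
move=> vw; rewrite /= /tree_ker; case: ifPn.
  by move=> /h[_ e]; rewrite asboolT.
move=> n; rewrite asboolF ?ltr01 // => e; case/negP: n; exact/h.
Qed.

(** * Counting cells that meet a set in positive measure *)

Section Counting.
Variable A : set X.
Hypothesis mA : measurable A.

Definition charged k j : bool := (0 < mu (A `&` cell k j))%E.

Definition ncharged k : nat := (\sum_(0 <= j < ncells k) charged k j)%N.

Lemma measurable_in_cell k j : measurable (A `&` cell k j).
Proof. by apply: measurableI => //; exact: measurable_cell. Qed.

Lemma charged_parent k j : charged k.+1 j -> charged k (j %/ gorder (g k))%N.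
Proof.
apply: subset_measure_gt0; [exact: measurable_in_cell..|].
by move=> x [Ax jx]; split=> //; rewrite /cell /= address_parent jx.
Qed.

Lemma measure_le_ncharged k :
  (mu A <= ((ncharged k)%:R / (ncells k)%:R)%:E)%E.
Proof.
apply: le_trans (le_sum_cells k mA) _.
rewrite /ncharged big_mkord natr_sum mulr_suml -sumEFin; apply: lee_sum => j _.
have [|] := boolP (charged k j); rewrite /charged => h.
  rewrite mul1r; apply: le_trans (cell_le k j).
  by apply: le_measure; rewrite ?inE //;
    [exact: measurable_in_cell|exact: measurable_cell].
by rewrite mul0r leNgt.
Qed.

Let sum_children k c : nat :=
  (\sum_(c * gorder (g k) <= j < c.+1 * gorder (g k)) charged k.+1 j)%N.

Let nchargedS k : ncharged k.+1 = (\sum_(0 <= c < ncells k) sum_children k c)%N.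
Proof. by rewrite /ncharged ncellsS big_nat_mul. Qed.

Let children_range k c j :
  (c * gorder (g k) <= j < c.+1 * gorder (g k))%N -> (j %/ gorder (g k) = c)%N.
Proof.
move=> /andP[lo hi]; apply/eqP; rewrite eqn_leq -ltnS ltn_divLR // hi /=.
by rewrite leq_divRL.
Qed.

Let sum_childrenE k c : sum_children k c =
  count (charged k.+1) (index_iota (c * gorder (g k)) (c.+1 * gorder (g k))).
Proof.
by rewrite -sum1_count [RHS]big_mkcond; apply: eq_bigr => j _; case: charged.
Qed.

Let size_children k c :
  size (index_iota (c * gorder (g k)) (c.+1 * gorder (g k))) = gorder (g k).
Proof. by rewrite size_iota mulSn addnK. Qed.

Let uncharged_children k c : ~~ charged k c -> sum_children k c = 0%N.
Proof.
move=> nc; rewrite /sum_children big_nat big1 // => j jr.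
apply/eqP; rewrite eqb0; apply: contra nc => /charged_parent.
by rewrite (children_range jr).
Qed.

Lemma ncharged_le k : (ncharged k.+1 <= ncharged k * gorder (g k))%N.
Proof.
rewrite nchargedS big_distrl /=; apply: leq_sum => c _.
have [_|/uncharged_children ->//] := boolP (charged k c).
by rewrite mul1n sum_childrenE (leq_trans (count_size _ _)) ?size_children.
Qed.

(** Group cells by parent: an uncharged parent has no charged child, and a charged one misses at
    least one. *)
Lemma ncharged_lt k :
  (forall c, exists2 i, (i < gorder (g k))%N & ~~ charged k.+1 (c * gorder (g
    k) + i)) ->
  (ncharged k.+1 <= ncharged k * (gorder (g k)).-1)%N.
Proof.
move=> bad; rewrite nchargedS big_distrl /=; apply: leq_sum => c _.
have [_|/uncharged_children ->//] := boolP (charged k c).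
rewrite mul1n -ltnS prednK // sum_childrenE -[X in (_ < X)%N](size_children k c).
rewrite ltn_neqAle count_size andbT -all_count.
have [i ib ni] := bad c; apply/allPn; exists (c * gorder (g k) + i)%N => //.
by rewrite mem_index_iota leq_addr /= mulSn addnC ltn_add2r.
Qed.

(* The proportion of charged cells bounds the measure of A and never increases;
   were every cell of level k to have an uncharged child whenever g k has order
   n, it would decrease by the factor 1 - 1/n infinitely often. *)
Lemma exists_full_cell (n : nat) (K : pred nat) : (0 < mu A)%E -> (0 < n)%N ->
  (forall k, K k -> gorder (g k) = n)
    -> (forall m, exists2 k, (m <= k)%N & K k) ->
  exists k c, K k /\ forall i, (i < n)%N -> charged k.+1 (c * n + i).
Proof.
move=> A0 n_gt0 Kn Kinf; apply: contrapT => none.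
pose p k : R := (ncharged k)%:R / (ncells k)%:R.
have pS k : p k.+1 <= p k.
  rewrite /p ler_pdivrMr // mulrAC ler_pdivlMr // -!natrM ler_nat ncellsS.
  rewrite [(ncells k * _)%N]mulnC mulnA.
  by apply: leq_mul; first exact: ncharged_le.
have p_le k l : (k <= l)%N -> p l <= p k.
  move=> /subnK <-; elim: (l - k)%N => [//|m IH].
  by rewrite addSn (le_trans (pS _)).
pose q : R := (n.-1)%:R / n%:R.
have nR : 0 < n%:R :> R by rewrite ltr0n.
have pK k : K k -> p k.+1 <= p k * q.
  move=> Kk; have := @ncharged_lt k; rewrite (Kn k Kk) => lt.
  have {lt} le : (ncharged k.+1 <= ncharged k * n.-1)%N.
    apply: lt => c; apply: contrapT => nc; apply: none; exists k, c;
      split=> // i ib.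
    by apply: contrapT => /negP ni; apply: nc; exists i.
  rewrite /p /q mulf_div ncellsS (Kn k Kk)
    -!natrM ler_pdivrMr ?ltr0n ?muln_gt0 -?(ltr0n R) ?n0 //.
  by rewrite divfK ?ler_nat // gt_eqF // natrM mulr_gt0.
have q01 : 0 <= q < 1.
  by rewrite divr_ge0 //= ltr_pdivrMr // mul1r ltr_nat prednK.
(* Between two levels of [K] the proportion does not grow, so each further level of [K] gains a
   factor [q]. *)
have small m : exists k, p k <= q ^+ m * p 0%N.
  elim: m => [|m [k kp]]; first by exists 0%N; rewrite mul1r.
  have [l kl /pK lp] := Kinf k; exists l.+1; apply: le_trans lp _.
  rewrite exprS mulrC -mulrA ler_wpM2l //; first by case/andP: q01.
  exact: le_trans (p_le _ _ kl) kp.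
have p0 : p 0%N <= 1.
  rewrite ler_pdivrMr // mul1r ler_nat /ncharged big_mkord.
  by rewrite -[X in (_ <= X)%N]card_ord -sum1_card leq_sum // => j _;
    exact: leq_b1.
have Af : mu A \is a fin_num by exact: fin_num_measure.
have fA0 : 0 < fine (mu A) by rewrite fine_gt0 // A0 -ge0_fin_numE ?Af.
have qnorm : `|q| < 1 by case/andP: q01 => q0 q1; rewrite ger0_norm.
(* Some power of [q] lies below the measure of [A], which the proportions bound from above. *)
have /cvgrPdist_lt/(_ _ fA0)[m _ /(_ m (leqnn m))] := cvg_expr qnorm.
rewrite sub0r normrN ger0_norm ?exprn_ge0 //; last by case/andP: q01.
apply/negP; rewrite -leNgt; have [k kp] := small m.
have := measure_le_ncharged k; rewrite -[mu A]fineK // lee_fin => /le_trans;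
  apply.
apply: le_trans kp _; rewrite ler_piMr // exprn_ge0 //.
by case/andP: q01.
Qed.
End Counting.
End Address.

(** * The family realized by the tree graphon *)

Section TreeGraphon.
Variables (R : realType) (F : set graph) (g : nat -> graph).
Hypotheses (Fiso : closed_under_iso F) (Fsub : closed_under_substitutions F)
  (Find : closed_under_induced_subgraphs F).
Hypotheses (Fg : forall k, F (g k)) (g2 : forall k, (2 <= gorder (g k))%N).
Hypothesis g_rec : forall G m, F G -> (2 <= gorder G)%N ->
  exists2 k, (m <= k)%N & giso (g k) G.
Local Notation W := (tree_graphon R g2).

(** A positive pattern contains a tuple of distinct points of the half-open unit interval. The
    kernel takes only the values 0 and 1, so these points induce exactly [G]. *)
Lemma Qfam_tree_graphon G : Qfam W G -> F G.
Proof.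
move=> /QfamP pG.
have mN : measurable (~` `[0%R, 1%R[ : set (measurableTypeR R)).
  by apply: measurableC.
have m1 (y : measurableTypeR R) : measurable [set y] by [].
have [x [px ux xN]] := exists_uniq_tuple m1 (@unit_prob_set1 R) mN
  (unit_prob_outside R) (@measurable_pattern _ W G) pG.
have x01 v : `[0%R, 1%R[%classic (tnth x v).
  by apply: contrapT => /(xN _ (mem_tnth v x)).
apply: (@tree_induced_in_family g _ (@address R g)
  _ _ F Fiso Fsub Find Fg G (tnth x)).
- by move=> k; exact: ltnW (g2 k).
- exact: address_parent.
- have a0 v : address g 0 (tnth x v) = 0%N.
    by apply/eqP; rewrite -leqn0 -ltnS; have := address_lt g2 0 (x01 v);
      rewrite /ncells big_ord0.
  by move=> v w; rewrite !a0.
- move=> v w vw; apply: (address_separates g2) => //.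
  by rewrite (inj_eq (tuple_uniqP x ux)).
- have /tree_patternP h := px.
  move=> v w; rewrite h; split=> [[]//|e]; split=> //.
  by apply/eqP => vw; rewrite vw in e; exact: tree_adj_irr e.
Qed.

Lemma Pfam_tree_graphon_large G : F G -> (2 <= gorder G)%N -> Pfam W G.
Proof.
move=> FG G2; apply/PfamP => A mA A0.
pose K k : bool := `[< giso (g k) G >].
have Kn k : K k -> gorder (g k) = gorder G.
  by move=> /asboolP[h [/bij_eq_card + _]]; rewrite !card_ord.
have Kinf m : exists2 k, (m <= k)%N & K k.
  by have [k mk kG] := g_rec m FG G2; exists k => //; apply/asboolP.
have [k [c [Kk full]]] :=
  exists_full_cell g2 mA A0 (ltnW G2) Kn Kinf.
have /asboolP/giso_sym[h [hB hadj]] := Kk.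
(* Each vertex gets the part of [A] in its own child of the full cell; the isomorphism [h] matches
   vertices of [G] with digits. Any choice of points from these parts realizes [G]. *)
pose D (v : 'V(G)) := A `&` cell g k.+1 (c * gorder G + h v).
have mD v : measurable (D v) by exact: measurable_in_cell.
have mP : measurable (@pattern _ W G `&` box (fun=> A)).
  by apply: measurableI; [exact: measurable_pattern|exact: measurable_box].
apply: (@subset_measure_gt0 _ _ _ _ (box D)) => //.
- exact: measurable_box.
- move=> x Dx; split; last by move=> v; case: (Dx v).
  apply/tree_patternP => v w.
  have ax u : address g k.+1 (tnth x u) = (c * gorder (g k) + h u)%N.
    by have [_ hu] := Dx u; rewrite [LHS]hu -(Kn k Kk).
  have ltb u : (h u < gorder (g k))%N by exact: ltn_ord.
  have g0 : (0 < gorder (g k))%N by exact: ltnW (g2 k).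
  have par u : address g k (tnth x u) = c.
    by rewrite address_parent // ax divnMDl // divn_small // addn0.
  have [->|vw] := eqVneq v w; first by rewrite adj_irr; split=> [|[]].
  have ne : address g k.+1 (tnth x v) <> address g k.+1 (tnth x w).
    rewrite !ax => /eqP; rewrite eqn_add2l => /eqP/val_inj/(bij_inj hB) E.
    by rewrite E eqxx in vw.
  have pe : address g k (tnth x v) = address g k (tnth x w) by rewrite !par.
  have sp := tree_adj_split (address_parent g2) pe ne.
  have te : tree_edge g k (address g k.+1 (tnth x v)) (address g k.+1 (tnth x w))
      = adj v w.
    rewrite /tree_edge !ax !divnMDl // !(divn_small (ltb _)) eqxx /=.
    by rewrite !modnMDl !modn_small // adjnE hadj.
  by rewrite -te; split=> [/sp|[_ /sp]].
have : (0 < \prod_(v < gorder G) gmeas W (D v))%E.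
  apply: (big_ind (fun y => 0 < y)%E) => // [y z|v _]; first exact: mule_gt0.
  by apply: full; apply: leq_trans (ltn_ord (h v)) _; rewrite (Kn k Kk).
by rewrite -(power_measure_box (gmeas W) mD).
Qed.

(** The chain of inclusions P, Q, [F], P closes up, which also gives weak randomness. *)
Lemma Pfam_tree_graphon : Pfam W = F.
Proof.
apply/seteqP; split=> G; first by move=> /Pfam_Qfam/Qfam_tree_graphon.
move=> FG; have [G1|] := leqP (gorder G) 1; last exact: Pfam_tree_graphon_large.
apply: Pfam_embeds (Pfam_tree_graphon_large (Fg 0) (g2 0)).
by apply: embeds_small => //; exact: ltnW (g2 0).
Qed.

Lemma weakly_random_tree_graphon : weakly_random W.
Proof.
apply/seteqP; split=> G; first exact: Pfam_Qfam.
by rewrite Pfam_tree_graphon; exact: Qfam_tree_graphon.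
Qed.
End TreeGraphon.

Lemma Pfam_closed_under_substitutions (R : realType) (W : graphon R) :
  closed_under_substitutions (Pfam W).
Proof. by move=> G H v; exact: Pfam_substitution. Qed.

Lemma Pfam_closed_under_induced_subgraphs (R : realType) (W : graphon R) :
  closed_under_induced_subgraphs (Pfam W).
Proof. by move=> G S; apply: Pfam_embeds; exact: induced_embeds. Qed.

Theorem theorem4p4 (R : realType) (F : set graph) :
  closed_under_iso F ->
  (exists G : graph, F G /\ (2 <= gorder G)%N) ->
  (strongly_persistent R F <-> persistent R F) /\
  (persistent R F <->
     closed_under_substitutions F /\ closed_under_induced_subgraphs F).
Proof.
move=> Fiso [G0 [FG0 G02]].
have strong_weak : strongly_persistent R F -> persistent R F.
  by move=> [W [_ ->]]; exists W.
have weak_closed : persistent R F ->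
    closed_under_substitutions F /\ closed_under_induced_subgraphs F.
  move=> [W ->]; split; first exact: Pfam_closed_under_substitutions.
  exact: Pfam_closed_under_induced_subgraphs.
have closed_strong : closed_under_substitutions F /\
    closed_under_induced_subgraphs F -> strongly_persistent R F.
  move=> [Fsub Find].
  have [g [Fg g2 g_rec]] := exists_recurrent_sequence Fiso FG0 G02.
  exists (tree_graphon R g2); split.
    exact: weakly_random_tree_graphon Fiso Fsub Find Fg g2 g_rec.
  by rewrite (Pfam_tree_graphon R Fiso Fsub Find Fg g2 g_rec).
tauto.
Qed.
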